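(* Let $\xi,\xi_1,\xi_2,\ldots$ be i.i.d. real-valued random variables with $\mathbb{E}\xi=0$ and $\mathbb{E}|\xi|^p<\infty$. Let $S_0:=0$, $S_n:=\xi_1+\cdots+\xi_n$ for $n\in\mathbb{N}$, and let $L_n$ be the perimeter of the convex hull of the planar point set $\{(j,S_j):j=0,\ldots,n\}$. Then, as $n\to\infty$, $\operatorname{Var}L_n=o(n^{3-p})$ if $p\in[2,3)$, and $\operatorname{Var}L_n=O(\log n)$ if $p\ge3$.
   Context: If the convex hull degenerates to a line segment, its perimeter is understood as twice the length of the segment. Equivalently, $L_n=L_n^{\smile}+L_n^{\frown}$, where $L_n^{\smile}$ and $L_n^{\frown}$ are the (Euclidean) lengths of the graphs of the convex minorant (largest convex function lying below) and of the concave majorant (least concave function lying above), on $[0,n]$, of the function obtained by linear interpolation of $S_0,S_1,\ldots,S_n$. *)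

(* Defs.v *)
From HB Require Import structures.
From mathcomp Require Export all_boot all_order all_algebra finmap.
From mathcomp Require Export all_classical all_reals all_analysis.

Set Implicit Arguments.
Unset Strict Implicit.
Unset Printing Implicit Defensive.

Export Order.TTheory GRing.Theory Num.Theory.
Export numFieldNormedType.Exports.

Local Open Scope classical_set_scope.
Local Open Scope ring_scope.
Local Open Scope convex_scope.

(* The norm of the product type R * R is the sup norm, so the Euclidean
   distance and the planar geometry below are spelled out in coordinates. *)

Section planar_convex_hull.
Context {R : realType}.

(* [R^o * R^o] is the plane as a vector space over R; [convex_lmodType] gives
   it the convex combinations [x <| t |> y = t *: x + (1 - t) *: y]. *)
Definition plane : Type := convex_lmodType (R^o * R^o)%type.

Definition convex_hull (A : set plane) : set plane :=
  smallest (@convex_set R (R^o * R^o)%type) A.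

Definition edist (x y : plane) : R :=
  Num.sqrt ((x.1 - y.1) ^+ 2 + (x.2 - y.2) ^+ 2).

Definition extreme_point (K : set plane) (z : plane) : Prop :=
  K z /\ forall (x y : plane) (t : {i01 R}), K x -> K y ->
    0 < t%:num -> t%:num < 1 -> z = x <| t |> y -> x = z /\ y = z.

(* The closed half-plane to the left of the line directed from p to q. *)
Definition left_half_plane (p q : plane) : set plane :=
  [set z : plane |
    0 <= (q.1 - p.1) * (z.2 - p.2) - (q.2 - p.2) * (z.1 - p.1)].

(* The sides of a convex polygon K, each given as the pair of its endpoints in
   counterclockwise order. If K is a segment pq with p <> q, then both (p, q)
   and (q, p) are sides. *)
Definition sides (K : set plane) : set (plane * plane) :=
  [set e | [/\ extreme_point K e.1, extreme_point K e.2, e.1 <> e.2 &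
               K `<=` left_half_plane e.1 e.2]].

(* The perimeter of a convex polygon (the convex hull of a finite set). By the
   remark above, that of a segment is twice its length; that of a point is 0. *)
Definition perimeter (K : set plane) : R :=
  \sum_(e \in sides K) edist e.1 e.2.

End planar_convex_hull.
Arguments plane : clear implicits.

Section random_walk.
Context {d : measure_display} {T : measurableType d} {R : realType}.
Variable P : probability T R.

Definition mutually_independent (X : nat -> {RV P >-> R}) : Prop :=
  forall (J : {fset nat}) (A : nat -> set R), (forall i, measurable (A i)) ->
    P (\bigcap_(i in [set` J]) (X i @^-1` A i)) =
    (\prod_(i <- J) P (X i @^-1` A i))%E.

Definition identically_distributed (X : nat -> {RV P >-> R}) : Prop :=
  forall (i j : nat) (A : set R), measurable A ->
    distribution P (X i) A = distribution P (X j) A.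

Definition iid (X : nat -> {RV P >-> R}) : Prop :=
  mutually_independent X /\ identically_distributed X.

(* [xi 0] is the generic copy of the increments; the walk uses xi 1, xi 2, ... *)
Definition walk (xi : nat -> {RV P >-> R}) (n : nat) (t : T) : R :=
  \sum_(1 <= i < n.+1) xi i t.

Definition walk_points (xi : nat -> {RV P >-> R}) (n : nat) (t : T) :
    set (plane R) :=
  [set (j%:R, walk xi j t) | j in [set j : nat | (j <= n)%N]].

Definition hull_perimeter (xi : nat -> {RV P >-> R}) (n : nat) (t : T) : R :=
  perimeter (convex_hull (walk_points xi n t)).

End random_walk.

(* Main.v *)
Require Import Defs.
From HB Require Import structures.
From mathcomp Require Import measurable_realfun ring lra zify.

Set Implicit Arguments.
Unset Strict Implicit.
Unset Printing Implicit Defensive.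

Local Open Scope classical_set_scope.
Local Open Scope ring_scope.

(* The perimeter is the sum of the lengths of the convex minorants of the walk
   and of its opposite. Setting the increment xi_i to 0 shifts the walk by a
   constant from time i on, and by convexity of sqrt (1 + s^2) this changes the
   length of the minorant by at most |xi_i| min(1, |b_i|), where b_i is the slope
   of one of the two minorants over [i - 1, i]. Comparing b_i with chords, |b_i|
   is at most C Z_i + |xi_i| / r, where r = min(i, n + 1 - i) and Z_i is a
   weighted maximum of partial sums without the increment xi_i; by Doob's
   inequality E Z_i^2 is at most C / r. The Efron-Stein inequality then bounds
   the variance by a multiple of
     sum_i 1 / i + E sum_i xi^4 / (|xi| + i)^2,
   and the last sum is at most xi^2 min(|xi|, n): its expectation is bounded if
   p >= 3, and is o(n^(3-p)) by dominated convergence if 2 <= p < 3. *)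

(** * The convex minorant of a sequence *)

(** Bounding the change of length by |xi_i| alone would only bound the variance by a multiple of n.
    The gain is that b_i is small, of order r^(-1/2), because the increments are centred. But b_i
    depends on xi_i, which may have no fourth moment, so the mean of xi_i^2 b_i^2 cannot be split by
    Cauchy-Schwarz. Hence b_i is compared with partial sums that omit xi_i: their maximum Z_i is
    independent of xi_i, two moments suffice for xi_i^2 Z_i^2, and the influence of xi_i on its own
    slope is isolated in |xi_i| / r. That term, capped by 1, is the only place where moments above
    the second matter. An increment is set to 0 rather than resampled: a variance is at most the
    mean square distance to any constant, so no independent copy of the walk has to be built.
    Expectation acts on functionals of a sequence, and independence enters through a single Fubini
    identity, [Ex_integ]. *)

Section arclength_density.
Context {R : realType}.
Implicit Types a b : R.

Definition hyp a : R := Num.sqrt (1 + a ^+ 2).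
Definition dhyp a : R := a / hyp a.

Lemma hyp_gt0 a : 0 < hyp a.
Proof. by rewrite sqrtr_gt0 ltr_pwDl // sqr_ge0. Qed.

Lemma sqr_hyp a : hyp a ^+ 2 = 1 + a ^+ 2.
Proof. by rewrite sqr_sqrtr // addr_ge0 // sqr_ge0. Qed.

(** After multiplication by [hyp a] this is the Cauchy-Schwarz inequality for (1, a) and (1, b). *)
Lemma hyp_subgradient a b : hyp a - hyp b <= dhyp a * (a - b).
Proof.
have [ha hb] := (hyp_gt0 a, hyp_gt0 b).
have ab : 1 + a * b <= hyp a * hyp b.
  have [h|h] := leP (1 + a * b) 0; first by rewrite (le_trans h) // mulr_ge0 // ltW.
  rewrite -(ler_pXn2r (n := 2)) ?nnegrE ?mulr_ge0 ?(ltW h) ?(ltW ha) ?(ltW hb) // exprMn !sqr_hyp.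
  have := sqr_ge0 (a - b); rewrite !expr2 => ?; lra.
rewrite /dhyp mulrAC ler_pdivlMr //.
by have := sqr_hyp a; nra.
Qed.

Lemma dhyp_nondecreasing a b : a <= b -> dhyp a <= dhyp b.
Proof.
rewrite le_eqVlt => /orP[/eqP-> //|ab].
have := hyp_subgradient a b; have := hyp_subgradient b a.
nra.
Qed.

Lemma normr_dhyp_le1 a : `|dhyp a| <= 1.
Proof.
rewrite /dhyp normrM normfV (gtr0_norm (hyp_gt0 a)) ler_pdivrMr ?hyp_gt0 // mul1r.
rewrite -(ler_pXn2r (n := 2)) ?nnegrE ?normr_ge0 ?(ltW (hyp_gt0 a)) // real_normK ?num_real //.
by rewrite sqr_hyp lerDr.
Qed.

Lemma normr_dhyp_le a : `|dhyp a| <= `|a|.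
Proof.
rewrite /dhyp normrM normfV (gtr0_norm (hyp_gt0 a)) ler_pdivrMr ?hyp_gt0 //.
apply: ler_peMr => //; rewrite -(ler_pXn2r (n := 2)) ?nnegrE ?(ltW (hyp_gt0 a)) //.
by rewrite sqr_hyp expr1n lerDl sqr_ge0.
Qed.

End arclength_density.

Section lower_polygon.
Context {R : realType}.
Implicit Types (x y : nat -> R) (n j k l m : nat) (s : R).

Definition chord x j k : R := (x k - x j) / (k%:R - j%:R).

Definition gap x j k l : R := x l - x j - chord x j k * (l%:R - j%:R).

(* The chord between the j-th and the k-th points is a maximal edge of the graph
   of the convex minorant of x on [0, n]. *)
Definition lower_side n x j k : bool :=
  [&& (j < k)%N, (k <= n)%N & [forall l : 'I_n.+1,
    (0 <= gap x j k l) && ((gap x j k l == 0) ==> (j <= l <= k)%N)]].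

Lemma chordM x j k : (j < k)%N -> chord x j k * (k%:R - j%:R) = x k - x j.
Proof. by move=> jk; rewrite /chord divfK // subr_eq0 eqr_nat gtn_eqF. Qed.

Lemma chord_unique x j k s : (j < k)%N -> x k - x j = s * (k%:R - j%:R) ->
  chord x j k = s.
Proof. by move=> jk; rewrite /chord => ->; rewrite mulfK // subr_eq0 eqr_nat gtn_eqF. Qed.

Lemma lower_sideI n x j k s : (j < k)%N -> (k <= n)%N ->
  x k - x j = s * (k%:R - j%:R) ->
  (forall l, (l <= n)%N -> 0 <= x l - x j - s * (l%:R - j%:R)) ->
  (forall l, (l <= n)%N -> x l - x j = s * (l%:R - j%:R) -> (j <= l <= k)%N) ->
  lower_side n x j k.
Proof.
move=> jk kn xs h0 h1; apply/and3P; split=> //; apply/forallP => l.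
have ln : (l <= n)%N by rewrite -ltnS.
rewrite /gap (chord_unique jk xs) h0 //=.
by apply/implyP; rewrite subr_eq0 => /eqP/h1; exact.
Qed.

Lemma lower_side_lt n x j k : lower_side n x j k -> (j < k)%N.
Proof. by case/and3P. Qed.

Lemma lower_side_le n x j k : lower_side n x j k -> (k <= n)%N.
Proof. by case/and3P. Qed.

Lemma lower_side_above n x j k l : lower_side n x j k -> (l <= n)%N ->
  chord x j k * (l%:R - j%:R) <= x l - x j.
Proof.
case/and3P=> jk kn /forallP h ln.
by have /andP[+ _] := h (Ordinal (ln : (l < n.+1)%N)); rewrite /gap /= subr_ge0.
Qed.

Lemma lower_side_on n x j k l : lower_side n x j k -> (l <= n)%N ->
  x l - x j = chord x j k * (l%:R - j%:R) -> (j <= l <= k)%N.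
Proof.
case/and3P=> jk kn /forallP h ln e.
have /andP[_ /implyP] := h (Ordinal (ln : (l < n.+1)%N)).
by rewrite /gap /= e subrr eqxx; exact.
Qed.

(** Among the chords passing over [m, m + 1], the lowest one supports the graph: a point below its
    line could replace one of its endpoints and give a lower chord. *)
Lemma lower_side_cover n x m : (m < n)%N ->
  exists j k, lower_side n x j k /\ (j <= m < k)%N.
Proof.
move=> mn.
(* Heights are compared at m + 1/2: at m itself all chords starting from m would tie. *)
pose hgt (e : 'I_n.+1 * 'I_n.+1) := x e.1 + chord x e.1 e.2 * (m%:R + 2^-1 - e.1%:R).
pose C := [pred e : 'I_n.+1 * 'I_n.+1 | (e.1 <= m < e.2)%N].
have Ce0 : C (ord0, ord_max) by rewrite /C /= mn.
case: (Order.TotalTheory.arg_minP hgt Ce0) => -[j k] /= /andP[jm mk] hmin.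
have jk : (j < k)%N by lia.
set s := chord x j k.
have xs : x k - x j = s * (k%:R - j%:R) by rewrite chordM.
have above l : (l <= n)%N -> 0 <= x l - x j - s * (l%:R - j%:R).
  move=> ln; have [lm|ml] := leqP l m.
    have := hmin (Ordinal (ln : (l < n.+1)%N), k); rewrite /C /= lm mk => /(_ isT).
    rewrite /hgt /= -/s => H.
    have lk : (l < k)%N by lia.
    have E := chordM x lk.
    have : (m.+1)%:R <= k%:R :> R by rewrite ler_nat.
    have : l%:R <= m%:R :> R by rewrite ler_nat.
    rewrite -natr1 => lmR mkR.
    set s' := chord x l k in H E.
    have : s' <= s by nra.
    nra.
  have := hmin (j, Ordinal (ln : (l < n.+1)%N)); rewrite /C /= jm ml => /(_ isT).
  rewrite /hgt /= -/s => H.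
  have jl : (j < l)%N by lia.
  have E := chordM x jl.
  have : (m.+1)%:R <= l%:R :> R by rewrite ler_nat.
  have : j%:R <= m%:R :> R by rewrite ler_nat.
  rewrite -natr1 => lmR mkR.
  set s' := chord x j l in H E.
  have : s <= s' by nra.
  nra.
(* The minimizing chord need not be maximal, so it is extended to the first and the last point on
   its line. *)
pose on l := (l <= n)%N && (x l - x j == s * (l%:R - j%:R)).
have onj : on j by rewrite /on !subrr mulr0 eqxx -ltnS ltn_ord.
have onk : on k by rewrite /on xs eqxx -ltnS ltn_ord.
have onn l : on l -> (l <= n)%N by case/andP.
have exon : exists l, on l by exists j.
case: (ex_minnP exon) => j1 onj1 minj1.
case: (ex_maxnP exon onn) => k1 onk1 maxk1.
have jj1 := minj1 _ onj; have kk1 := maxk1 _ onk.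
have /andP[_ /eqP ej1] := onj1; have /andP[k1n /eqP ek1] := onk1.
exists j1, k1; split; last by lia.
apply: (@lower_sideI _ _ _ _ s) => //; first by lia.
- by lra.
- by move=> l ln; have := above _ ln; lra.
- move=> l ln e; have onl : on l by rewrite /on ln /=; apply/eqP; lra.
  by rewrite minj1 // maxk1.
Qed.

(** Each line stays below the graph, hence below the other chord, so the two agree on [m, m + 1] and
    are the same line. The points j' and k' then lie on the line of the first side, and
    [lower_side_on] confines them to it. *)
Lemma lower_side_nested n x j k j' k' m :
  lower_side n x j k -> (j <= m < k)%N ->
  lower_side n x j' k' -> (j' <= m < k')%N -> (j <= j')%N && (k' <= k)%N.
Proof.
move=> L /andP[jm mk] L' /andP[jm' mk'].
have [jk jk'] := (lower_side_lt L, lower_side_lt L').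
have [kn kn'] := (lower_side_le L, lower_side_le L').
have E := chordM x jk; have E' := chordM x jk'.
have H1 := lower_side_above L kn'.
have H2 := lower_side_above L (leq_trans (ltnW jk') kn').
have H3 := lower_side_above L' kn.
have H4 := lower_side_above L' (leq_trans (ltnW jk) kn).
have O1 := @lower_side_on _ _ _ _ j' L (leq_trans (ltnW jk') kn').
have O2 := @lower_side_on _ _ _ _ k' L kn'.
set s := chord x j k in E H1 H2 O1 O2; set s' := chord x j' k' in E' H3 H4.
have a1 : j%:R <= m%:R :> R by rewrite ler_nat.
have a2 : j'%:R <= m%:R :> R by rewrite ler_nat.
have a3 : m%:R + 1 <= k%:R :> R by rewrite natr1 ler_nat.
have a4 : m%:R + 1 <= k'%:R :> R by rewrite natr1 ler_nat.
(* [d] is the difference of the two supporting lines. *)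
pose d t := x j' + s' * (t - j'%:R) - (x j + s * (t - j%:R)).
have d0 t : m%:R <= t <= m%:R + 1 -> d t = 0.
  move=> /andP[t1 t2]; apply/eqP; rewrite eq_le; apply/andP; split.
    suff : d t * (k%:R - j%:R) <= 0 by rewrite pmulr_lle0 // subr_gt0 ltr_nat.
    suff : d t * (k%:R - j%:R) = d j%:R * (k%:R - t) + d k%:R * (t - j%:R).
      by move=> ->; rewrite -oppr_ge0 opprD addr_ge0 // -mulNr mulr_ge0 // /d; lra.
    by rewrite /d; ring.
  suff : 0 <= d t * (k'%:R - j'%:R) by rewrite pmulr_lge0 // subr_gt0 ltr_nat.
  suff : d t * (k'%:R - j'%:R) = d j'%:R * (k'%:R - t) + d k'%:R * (t - j'%:R).
    by move=> ->; rewrite addr_ge0 // mulr_ge0 // /d; lra.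
  by rewrite /d; ring.
have := d0 m%:R; have := d0 (m%:R + 1); rewrite !lexx !lerDl ler01 => /(_ isT) e1 /(_ isT) e2.
have ss : s = s' by move: e1 e2; rewrite /d; lra.
move: e1 e2; rewrite /d -ss => e1 e2; rewrite -ss in E'.
by have := O1 _; have := O2 _; move=> /(_ ltac:(lra)) + /(_ ltac:(lra)); lia.
Qed.

Lemma lower_side_unique n x j k j' k' m :
  lower_side n x j k -> (j <= m < k)%N ->
  lower_side n x j' k' -> (j' <= m < k')%N -> (j = j') * (k = k').
Proof.
move=> L M L' M'.
by have := lower_side_nested L M L' M'; have := lower_side_nested L' M' L M; split; lia.
Qed.

Definition lower_length n x : R :=
  \sum_(e : 'I_n.+1 * 'I_n.+1 | lower_side n x e.1 e.2)
    Num.sqrt ((e.2%:R - e.1%:R) ^+ 2 + (x e.2 - x e.1) ^+ 2).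

(** For m < n exactly one side passes over [m, m + 1] and the sum has a single term; for m >= n it
    is empty. The sum avoids choosing that side. *)
Definition lower_slope n x m : R :=
  \sum_(e : 'I_n.+1 * 'I_n.+1 | lower_side n x e.1 e.2 && (e.1 <= m < e.2)%N)
    chord x e.1 e.2.

Lemma sum_lower_cover n x m j k (f : nat -> nat -> R) :
  lower_side n x j k -> (j <= m < k)%N ->
  \sum_(e : 'I_n.+1 * 'I_n.+1 | lower_side n x e.1 e.2 && (e.1 <= m < e.2)%N)
    f e.1 e.2 = f j k.
Proof.
move=> L M.
have kn : (k < n.+1)%N by exact: (lower_side_le L).
have jn : (j < n.+1)%N by have := lower_side_lt L; lia.
rewrite (big_pred1 (Ordinal jn, Ordinal kn)) //= => -[j' k'] /=.
apply/andP/eqP => [[L' M']|[-> ->]//].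
by have [e1 e2] := lower_side_unique L' M' L M; congr pair; apply/val_inj.
Qed.

Lemma lower_slopeE n x j k m : lower_side n x j k -> (j <= m < k)%N ->
  lower_slope n x m = chord x j k.
Proof. exact: sum_lower_cover. Qed.

Lemma chord_length x j k : (j < k)%N ->
  Num.sqrt ((k%:R - j%:R) ^+ 2 + (x k - x j) ^+ 2)
  = hyp (chord x j k) * (k%:R - j%:R).
Proof.
move=> jk; have p : 0 <= k%:R - j%:R :> R by rewrite subr_ge0 ler_nat ltnW.
rewrite /hyp -{2}(ger0_norm p) -sqrtr_sqr -sqrtrM; last by rewrite addr_ge0 // sqr_ge0.
by rewrite -(chordM x jk); congr Num.sqrt; ring.
Qed.

Lemma sum_between (n j k : nat) (c : R) : (j <= k)%N -> (k <= n)%N ->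
  \sum_(m < n | (j <= m < k)%N) c = c * (k%:R - j%:R).
Proof.
move=> jk kn; rewrite -natrB // mulr_natr.
rewrite -(big_mkord (fun m => (j <= m < k)%N) (fun=> c)) /=.
rewrite (big_cat_nat (n := k)) //= (big_cat_nat (n := j)) //=.
rewrite big_nat_cond big1 ?add0r; last by move=> i; lia.
rewrite [X in _ + X]big_nat_cond [X in _ + X]big1 ?addr0; last by move=> i; lia.
rewrite big_nat_cond (eq_bigl (fun i => (j <= i < k)%N)); last by move=> i; lia.
by rewrite -big_nat sumr_const_nat.
Qed.

Lemma lower_lengthE n x : lower_length n x = \sum_(m < n) hyp (lower_slope n x m).
Proof.
rewrite /lower_length.
transitivity (\sum_(e : 'I_n.+1 * 'I_n.+1 | lower_side n x e.1 e.2)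
   \sum_(m < n | (e.1 <= m < e.2)%N) hyp (chord x e.1 e.2)).
  apply: eq_bigr => e L; have jk := lower_side_lt L.
  by rewrite sum_between ?(lower_side_le L) ?(ltnW jk) // chord_length.
rewrite (exchange_big_dep xpredT) //=; apply: eq_bigr => m _.
have [j [k [L M]]] := lower_side_cover x (ltn_ord m).
rewrite (lower_slopeE L M).
exact: (sum_lower_cover (fun j k => hyp (chord x j k)) L M).
Qed.

(** Integrating the slopes, instead of interpolating along the sides, makes the increments available
    at once; the agreement with [x] at the ends of the sides is then proved. *)
Definition minorant n x l : R := x 0%N + \sum_(m < l) lower_slope n x m.

Lemma minorantS n x l : minorant n x l.+1 = minorant n x l + lower_slope n x l.
Proof. by rewrite /minorant big_ord_recr /= addrA. Qed.

Lemma minorant_on_side n x j k l : lower_side n x j k -> (j <= l <= k)%N ->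
  minorant n x l = minorant n x j + chord x j k * (l%:R - j%:R).
Proof.
move=> L /andP[jl lk]; elim: l jl lk => [|l IH] jl lk.
  have j0 : j = 0%N by lia.
  by rewrite j0 subrr mulr0 addr0.
have [->|jl'] := eqVneq j l.+1; first by rewrite subrr mulr0 addr0.
rewrite minorantS IH; try by lia.
rewrite (@lower_slopeE n x j k) //; last by lia.
by rewrite -natr1; ring.
Qed.

(** Strong induction along the sides: the side over the step before j ends at j, since otherwise it
    would also cover the step after j and, by uniqueness, start at j. *)
Lemma minorant_start n x j k : lower_side n x j k -> minorant n x j = x j.
Proof.
elim/ltn_ind: j k => -[_ k _|j IH k L]; first by rewrite /minorant big_ord0 addr0.
have [jk kn] := (lower_side_lt L, lower_side_le L).
have jn : (j < n)%N by lia.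
have [j' [k' [L' M']]] := lower_side_cover x jn.
have [k'j|k'j] := eqVneq k' j.+1; last first.
  by have [] := lower_side_unique (m := j.+1) L ltac:(lia) L' ltac:(lia); lia.
subst k'; rewrite (minorant_on_side (l := j.+1) L'); last by lia.
rewrite (IH _ _ _ L'); last by lia.
by rewrite chordM ?(lower_side_lt L') // addrC subrK.
Qed.

Lemma minorant_end n x j k : lower_side n x j k -> minorant n x k = x k.
Proof.
move=> L; have jk := lower_side_lt L.
rewrite (minorant_on_side (l := k) L); last by lia.
by rewrite (minorant_start L) chordM // addrC subrK.
Qed.

Lemma minorant0 n x : minorant n x 0 = x 0%N.
Proof. by rewrite /minorant big_ord0 addr0. Qed.

Lemma minorantn n x : minorant n x n = x n.
Proof.
case: n => [|n]; first exact: minorant0.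
have [j [k [L M]]] := lower_side_cover x (ltnSn n).
have kn := lower_side_le L; have e : k = n.+1 by lia.
by rewrite -{2}e (minorant_end L) e.
Qed.

Lemma minorant_le n x l : (l <= n)%N -> minorant n x l <= x l.
Proof.
rewrite leq_eqVlt => /orP[/eqP->|ln]; first by rewrite minorantn.
have [j [k [L M]]] := lower_side_cover x ln.
rewrite (minorant_on_side L); last by lia.
rewrite (minorant_start L) addrC -lerBrDr.
exact: lower_side_above L (ltnW ln).
Qed.

(** The minorant bends only at points of the graph, and only upwards, because at m + 1 either one
    side continues or two sides meet. This is how convexity enters the summation by parts in
    [lower_length_shift]. *)
Lemma lower_slope_step n x m : (m.+1 < n)%N ->
  lower_slope n x m = lower_slope n x m.+1 \/
  (lower_slope n x m <= lower_slope n x m.+1 /\ minorant n x m.+1 = x m.+1).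
Proof.
move=> mn.
have [j [k [L M]]] := lower_side_cover x (ltnW mn).
have [j' [k' [L' M']]] := lower_side_cover x mn.
rewrite (lower_slopeE L M) (lower_slopeE L' M').
have [ek|mk] := eqVneq k m.+1; last first.
  by left; have [-> ->] := lower_side_unique (m := m.+1) L ltac:(lia) L' M'.
have ej' : j' = m.+1.
  have [//|ne] := eqVneq j' m.+1.
  by have [] := lower_side_unique (m := m) L M L' ltac:(lia); lia.
right; split; last by rewrite -ek (minorant_end L).
have kn' := lower_side_le L'.
have jk := lower_side_lt L; have jk' := lower_side_lt L'.
have H := lower_side_above L kn'.
have E := chordM x jk; have E' := chordM x jk'.
rewrite ej' ek in E E' jk' H *.
have : (m.+1)%:R < k'%:R :> R by rewrite ltr_nat.
nra.
Qed.

(** The witness is the left end of the side over [m, m + 1]; [chord_le_slope] takes the right end.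
    These two properties are all that [slope_bound] uses of the minorant. *)
Lemma slope_le_chord n x m : (m < n)%N -> exists2 j, (j <= m)%N &
  forall k, (m < k <= n)%N -> lower_slope n x m <= chord x j k.
Proof.
move=> mn; have [j [k0 [L M]]] := lower_side_cover x mn.
exists j; first by case/andP: M.
move=> k mk; rewrite (lower_slopeE L M) [leRHS]/chord ler_pdivlMr; last first.
  by rewrite subr_gt0 ltr_nat; lia.
by apply: lower_side_above L _; lia.
Qed.

Lemma chord_le_slope n x m : (m < n)%N -> exists2 k, (m < k <= n)%N &
  forall j, (j <= m)%N -> chord x j k <= lower_slope n x m.
Proof.
move=> mn; have [j0 [k [L M]]] := lower_side_cover x mn.
have kn := lower_side_le L.
exists k; first by lia.
move=> j jm; rewrite (lower_slopeE L M) [leLHS]/chord ler_pdivrMr; last first.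
  by rewrite subr_gt0 ltr_nat; lia.
have jn : (j <= n)%N by lia.
have := lower_side_above L jn.
have := chordM x (lower_side_lt L); lra.
Qed.

(* With e the difference of the minorants and H = dhyp of the
   slopes of the minorant of y, convexity bounds the left-hand side by
   sum_m H m * (e m.+1 - e m). Subtracting D 1_(i < m) from e gives f, which
   vanishes at both ends and is nonnegative where H jumps: sum by parts. *)
Lemma lower_length_shift n x y (i : nat) (D : R) : (i < n)%N ->
  (forall l, y l = x l + D *+ (i < l)%N) ->
  lower_length n y - lower_length n x <= D * dhyp (lower_slope n y i).
Proof.
move=> i_n yx; rewrite !lower_lengthE -sumrB.
pose H m := dhyp (lower_slope n y m).
pose f m := minorant n y m - minorant n x m - D *+ (i < m)%N.
have f0 : f 0%N = 0 by rewrite /f !minorant0 yx /= mulr0n; ring.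
have fn : f n = 0 by rewrite /f !minorantn yx i_n /=; ring.
(* Keeping the boundary term [H m * f m.+1] on the right, each further step only has to absorb the
   product of a jump of [H] with a value of [f]. *)
have fH m : (m < n)%N -> \sum_(k < m.+1) H k * (f k.+1 - f k) <= H m * f m.+1.
  elim: m => [_|m IH mn]; first by rewrite big_ord_recr big_ord0 /= f0 subr0 add0r.
  rewrite big_ord_recr /=; apply: le_trans (lerD (IH (ltnW mn)) (lexx _)) _.
  suff : (H m.+1 - H m) * f m.+1 >= 0 by lra.
  rewrite /H; case: (lower_slope_step y mn) => [->|[hle e]].
    by rewrite subrr mul0r.
  apply: mulr_ge0; first by rewrite subr_ge0 dhyp_nondecreasing.
  (* At a corner the minorant of [y] equals [y], so the shift cancels and [f] is the height of [x]
     above its own minorant. *)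
  by have := minorant_le x (ltnW mn); rewrite /f e yx; lra.
apply: (@le_trans _ _ (\sum_(m < n) (H m * (f m.+1 - f m) + (H m * D) *+ (m == i :> nat)))).
  apply: ler_sum => m _; apply: le_trans (hyp_subgradient _ _) _.
  rewrite -/(H m) /f !minorantS.
  have [e|ne] := eqVneq (m : nat) i.
    by rewrite e ltnn ltnSn /= !mulr1n mulr0n; lra.
  have -> : (i < m.+1)%N = (i < m)%N by lia.
  by rewrite mulr0n; lra.
have S2 : \sum_(m < n) (H m * D) *+ (m == i :> nat) = H i * D.
  rewrite (bigD1 (Ordinal i_n)) //= eqxx mulr1n big1 ?addr0 // => m mi.
  have [e|_] := eqVneq (m : nat) i; last by rewrite mulr0n.
  by case/eqP: mi; apply: val_inj.
rewrite big_split /= S2.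
have : \sum_(m < n) H m * (f m.+1 - f m) <= 0.
  case: (n) fn i_n fH => // n' fn _ fH.
  by have := fH n' (ltnSn _); rewrite fn mulr0.
rewrite -/(H i); lra.
Qed.

End lower_polygon.

(** * Pathwise bounds *)

Section maximal.
Context {R : realType}.
Implicit Types (x t w : nat -> R) (i j k l n r : nat) (u : R).

Definition psum x k : R := \sum_(1 <= j < k.+1) x j.

Definition upd x i u : nat -> R := fun j => if j == i then u else x j.

Fixpoint runmax t n : R := if n is m.+1 then Num.max (runmax t m) (t n) else 0.

(** Doob's inequality below is one-sided, so the maximal absolute value is replaced by the sum of
    the two one-sided maxima. The sign is carried by the weights, so that both terms are running
    maxima of weighted sums of the same variables. *)
Definition maxsum w n x : R :=
  runmax (psum (fun j => w j * x j)) n + runmax (psum (fun j => - w j * x j)) n.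

Lemma psum0 x : psum x 0 = 0.
Proof. by rewrite /psum big_nil. Qed.

Lemma psumS x k : psum x k.+1 = psum x k + x k.+1.
Proof. by rewrite /psum big_nat_recr. Qed.

Lemma psumN x k : psum (fun j => - x j) k = - psum x k.
Proof. by rewrite /psum sumrN. Qed.

Lemma eq_psum x y k : (forall j, (1 <= j <= k)%N -> x j = y j) -> psum x k = psum y k.
Proof. by move=> xy; rewrite /psum; apply: eq_big_nat => j; exact: xy. Qed.

Lemma runmax_ge0 t n : 0 <= runmax t n.
Proof. by elim: n => //= n IH; rewrite le_max IH. Qed.

Lemma le_runmax t n k : (0 < k <= n)%N -> t k <= runmax t n.
Proof.
elim: n => [|n IH] /=; first by lia.
have [->|kn] := eqVneq k n.+1; first by rewrite le_max lexx orbT.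
by move=> ?; rewrite le_max IH //; lia.
Qed.

Lemma maxsum_ge0 w n x : 0 <= maxsum w n x.
Proof. by rewrite addr_ge0 // runmax_ge0. Qed.

Lemma maxsumN w n x : maxsum w n (fun j => - x j) = maxsum w n x.
Proof.
rewrite /maxsum addrC; congr (runmax (psum _) _ + runmax (psum _) _);
by apply/funext => j; ring.
Qed.

Lemma le_maxsum w n x k : (k <= n)%N -> `|psum (fun j => w j * x j) k| <= maxsum w n x.
Proof.
case: k => [|k] kn; first by rewrite psum0 normr0 maxsum_ge0.
have kn' : (0 < k.+1 <= n)%N by [].
rewrite ler_norml /maxsum.
have := le_runmax (psum (fun j => w j * x j)) kn'.
have := le_runmax (psum (fun j => - w j * x j)) kn'.
have -> : psum (fun j => - w j * x j) k.+1 = - psum (fun j => w j * x j) k.+1.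
  by rewrite -psumN; apply: eq_psum => j _; ring.
have := runmax_ge0 (psum (fun j => w j * x j)) n.
have := runmax_ge0 (psum (fun j => - w j * x j)) n.
by move=> ? ? ? ?; apply/andP; split; lra.
Qed.

(** The decay like 1/j makes one maximum control partial sums at all scales k >= r, with |psum x k|
    / k at most twice it; being flat up to r keeps the sum of the squared weights of order 1/r. *)
Definition weight r j : R := (maxn r j)%:R^-1.

(* Summation by parts, the weights being the inverses of an increasing sequence. *)
Lemma psum_le_maxsum r n x k : (0 < r)%N -> (k <= n)%N ->
  `|psum x k| <= 2 * (maxn r k)%:R * maxsum (weight r) n x.
Proof.
move=> r0; set Z := maxsum _ _ _; pose v j : R := (maxn r j)%:R.
pose T := psum (fun j => weight r j * x j).
have Z0 : 0 <= Z by exact: maxsum_ge0.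
have v0 j : v j != 0 by rewrite /v pnatr_eq0; lia.
have TS l : T l.+1 = T l + (v l.+1)^-1 * x l.+1 by rewrite /T psumS.
have vS l : v l <= v l.+1 by rewrite ler_nat; lia.
suff main : (k <= n)%N -> `|psum x k - v k * T k| <= (v k - v 0%N) * Z.
  move=> kn; have := main kn; have := le_maxsum (weight r) x kn.
  rewrite -/(T k) -/Z -/(v k) => TZ H.
  have : 0 <= v 0%N by rewrite ler0n.
  have : 0 <= v k by rewrite ler0n.
  have : `|psum x k| <= `|psum x k - v k * T k| + v k * `|T k|.
    rewrite -[X in X * `|T k|](ger0_norm (ler0n R _)) -normrM.
    by apply: le_trans (ler_normD _ _); rewrite subrK.
  nra.
elim: k => [|k IH] kn; first by rewrite psum0 /T psum0 !mulr0 !subrr mul0r normr0.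
have := IH (ltnW kn); have := le_maxsum (weight r) x (ltnW kn).
rewrite -/(T k) -/Z => TZ {}IH.
have -> : psum x k.+1 - v k.+1 * T k.+1
    = (psum x k - v k * T k) - (v k.+1 - v k) * T k.
  by rewrite psumS TS mulrDr mulVKf //; ring.
apply: le_trans (ler_normB _ _) _.
have := vS k; rewrite -subr_ge0 => dv.
rewrite normrM (ger0_norm dv); nra.
Qed.

Lemma psum_upd x i k : (0 < i)%N -> psum x k = psum (upd x i 0) k + x i *+ (i <= k)%N.
Proof.
move=> i0; elim: k => [|k IH]; first by rewrite !psum0 leqn0 gtn_eqF // mulr0n addr0.
rewrite !psumS IH /upd; have [<-|ki] := eqVneq k.+1 i.
  by rewrite ltnn leqnn mulr0n mulr1n; ring.
have -> : (i <= k.+1)%N = (i <= k)%N by lia.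
by ring.
Qed.

(* The [i]-th slope [b] of the minorant is compared with the chords over [0, k]
   and over [j, 2 i - 1]. *)
Lemma slope_bound b D i n x s : (0 < i)%N -> (i.*2 <= n.+1)%N ->
  (forall l, (l <= n)%N -> s l = s 0%N + psum x l + D *+ (i <= l)%N) ->
  (exists2 j, (j < i)%N & forall k, (i <= k <= n)%N -> b <= chord s j k) ->
  (exists2 k, (i <= k <= n)%N & forall j, (j < i)%N -> chord s j k <= b) ->
  `|b| <= 6 * maxsum (weight i) n x + `|D| / i%:R.
Proof.
move=> i0 i2n sE [j ji up] [k ikn lo].
have [k0 kn] : (0 < k)%N /\ (k <= n)%N by lia.
have [ik ik'] : (i <= k)%N /\ maxn i k = k by lia.
(* The chord from j < i to 2 i - 1 has horizontal length at least i and ends inside [0, n]. The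
   partial sums at its ends are at most 4 i Z and 2 i Z in absolute value, whence the constant 6. *)
set k1 := (i.*2.-1)%N.
have [k1n jk1] : (k1 <= n)%N /\ (j < k1)%N by lia.
have [jn ik1] : (j <= n)%N /\ (i <= k1)%N by lia.
have [ij ik1'] : (i <= j)%N = false /\ maxn i k1 = k1 by lia.
have [k1_le d_ge] : (k1 <= 2 * i)%N /\ (i + j <= k1)%N by lia.
have i0' : 0 < i%:R :> R by rewrite ltr0n.
move: k1_le d_ge; rewrite -(ler_nat R) natrM -(ler_nat R) natrD => k1_le d_ge.
have Z0 : 0 <= maxsum (weight i) n x by exact: maxsum_ge0.
have P1 := psum_le_maxsum x i0 kn.
have P2 := psum_le_maxsum x i0 k1n.
have P3 := psum_le_maxsum x i0 jn.
move: P1 P2 P3 Z0; rewrite ik' ik1' (maxn_idPl (ltnW ji)).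
move: (maxsum _ _ _) => Z P1 P2 P3 Z0.
have e0 : `|D| / i%:R * i%:R = `|D| by rewrite divfK // gt_eqF.
have : 0 <= `|D| / i%:R by rewrite divr_ge0.
have [D1 D2] : - `|D| <= D /\ D <= `|D|.
  by apply/andP; rewrite -ler_norml.
move: (`|D| / i%:R) e0 => e e0 e_ge0.
have sk := sE k kn; have s1 := sE k1 k1n; have sj := sE j jn.
move: sk s1 sj; rewrite ik ik1 ij !mulr1n mulr0n addr0 => sk s1 sj.
have H1 := lo 0%N i0; have E1 := chordM s k0.
have H2 := up k1 ltac:(by rewrite ik1 k1n); have E2 := chordM s jk1.
have dp : 0 < k1%:R - j%:R :> R by rewrite subr_gt0 ltr_nat.
have k0' : 0 < k%:R :> R by rewrite ltr0n.
move: ik; rewrite -(ler_nat R) => ik.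
clear sE up lo ikn i2n ik' ik1 ij ik1' kn k1n jn i0 ji k0 jk1.
move: P1 P2 P3; rewrite !ler_norml => /andP[B1 _] /andP[_ B3] /andP[B4 _].
apply/andP; split.
  apply: le_trans _ H1; rewrite -(ler_pM2r k0').
  move: E1; rewrite subr0 sk => E1; rewrite E1.
  have : e * i%:R <= e * k%:R by rewrite ler_wpM2l.
  have : 0 <= Z * k%:R by rewrite mulr_ge0 // ltW.
  clear -B1 D1 e0; move=> ? ?; lra.
apply: le_trans H2 _; rewrite -(ler_pM2r dp) E2 s1 sj.
have : Z * k1%:R <= Z * (2 * i%:R) by rewrite ler_wpM2l.
have : (6 * Z + e) * i%:R <= (6 * Z + e) * (k1%:R - j%:R).
  by rewrite ler_wpM2l; lra.
clear -B3 B4 D2 e0; move=> ? ?; lra.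
Qed.

(* For [i] in the right half the increments are read backwards. *)
Definition rho n i j : nat := if (i.*2 <= n.+1)%N then j else (n.+1 - j)%N.

Definition dist_to_end n i : nat := minn i (n.+1 - i).

Definition outer_maxsum n i x : R :=
  maxsum (weight (dist_to_end n i)) n (fun j => x (rho n i j)).

Lemma outer_maxsumN n i x : outer_maxsum n i (fun j => - x j) = outer_maxsum n i x.
Proof. exact: maxsumN. Qed.

Lemma psum_rev n x l : (l <= n)%N ->
  psum x n - psum x (n - l) = psum (fun j => x (n.+1 - j)%N) l.
Proof.
elim: l => [|l IH] ln; first by rewrite subn0 subrr psum0.
rewrite psumS -IH ?(ltnW ln) //.
have -> : (n - l = (n - l.+1).+1)%N by lia.
by rewrite psumS (_ : (n.+1 - l.+1 = (n - l.+1).+1)%N); [ring|lia].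
Qed.

(** In the right half the path is reversed in time: chords change sign, and the two ends of the side
    exchange their roles. The reversed path starts from s n, which is why [slope_bound] allows any
    initial value. *)
Lemma lower_slope_bound D i n x s : (0 < i <= n)%N ->
  (forall l, (l <= n)%N -> s l = psum x l + D *+ (i <= l)%N) ->
  `|lower_slope n s i.-1| <= 6 * outer_maxsum n i x + `|D| / (dist_to_end n i)%:R.
Proof.
move=> /andP[i0 i_n] sE; rewrite /outer_maxsum /rho /dist_to_end.
have i1n : (i.-1 < n)%N by lia.
have [j ji up] := slope_le_chord s i1n.
have [k ki lo] := chord_le_slope s i1n.
have [i2n|i2n] := leqP i.*2 n.+1.
  rewrite (minn_idPl _); last by lia.
  apply: (@slope_bound _ _ _ _ _ s) => //.
  - by move=> l ln; rewrite (sE 0%N) // psum0 leqn0 gtn_eqF // mulr0n addr0 add0r sE.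
  - by exists j; [lia|move=> k' ?; apply: up; lia].
  - by exists k; [lia|move=> j' ?; apply: lo; lia].
rewrite (minn_idPr _); last by lia.
rewrite -normrN -(normrN D) -maxsumN.
pose s' l := s (n - l)%N.
have chord_rev j' k' : (j' <= n)%N -> (k' <= n)%N ->
    chord s' (n - k') (n - j') = - chord s j' k'.
  move=> jn kn; rewrite /chord /s' !subKn // !natrB // -[in RHS]mulrN -invrN.
  by rewrite -mulrNN -invrN opprB; congr (_ * _^-1); ring.
apply: (@slope_bound _ _ _ _ _ s'); [lia|lia|..].
- move=> l ln; rewrite /s' subn0 !sE //; last by lia.
  rewrite (psumN (fun j => x (n.+1 - j)%N)) -psum_rev // i_n.
  have -> : (n.+1 - i <= l)%N = ~~ (i <= n - l)%N by lia.
  by case: (i <= n - l)%N => /=; rewrite ?mulr1n ?mulr0n; ring.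
- exists (n - k)%N; first by lia.
  move=> k' ?; rewrite -[k'](@subKn _ n); last by lia.
  by rewrite chord_rev ?lerN2; [apply: lo; lia|lia|lia].
- exists (n - j)%N; first by lia.
  move=> j' ?; rewrite -[j'](@subKn _ n); last by lia.
  by rewrite chord_rev ?lerN2; [apply: up; lia|lia|lia].
Qed.

(** [lower_length_shift] is one-sided, so it is applied in both directions. One involves the slope
    with the increment present, the other the slope without it; the latter obeys the bound with
    shift 0, hence also the larger one. *)
Lemma lower_length_upd n i x : (0 < i <= n)%N ->
  `|lower_length n (psum x) - lower_length n (psum (upd x i 0))| <=
  `|x i| * Num.min 1 (6 * outer_maxsum n i (upd x i 0)
                      + `|x i| / (dist_to_end n i)%:R).
Proof.
move=> /[dup] i1n /andP[i0 i_n]; set b := (X in Num.min 1 X).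
have i1n' : (i.-1 < n)%N by lia.
have dle s : `|lower_slope n s i.-1| <= b -> `|dhyp (lower_slope n s i.-1)| <= Num.min 1 b.
  by move=> h; rewrite le_min normr_dhyp_le1 (le_trans (normr_dhyp_le _) h).
have d1 : `|dhyp (lower_slope n (psum x) i.-1)| <= Num.min 1 b.
  by apply/dle/lower_slope_bound => // l ln; rewrite -psum_upd.
have d0 : `|dhyp (lower_slope n (psum (upd x i 0)) i.-1)| <= Num.min 1 b.
  apply: dle; apply: le_trans (lower_slope_bound (D := 0) (x := upd x i 0) i1n _) _.
    by move=> l ln; rewrite mul0rn addr0.
  by rewrite normr0 mul0r /b lerD2l divr_ge0.
have h1 := @lower_length_shift _ n (psum (upd x i 0)) (psum x) i.-1 (x i) i1n' _.
have h2 := @lower_length_shift _ n (psum x) (psum (upd x i 0)) i.-1 (- x i) i1n' _.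
have {}h1 := h1 (fun l => ltac:(rewrite (psum_upd x l i0) prednK //)).
have {}h2 := h2 (fun l => ltac:(rewrite (psum_upd x l i0) prednK // mulNrn addrK //)).
have bnd u v : `|v| <= Num.min 1 b -> u * v <= `|u| * Num.min 1 b.
  move=> h; apply: le_trans (ler_norm _) _.
  by rewrite normrM ler_wpM2l.
rewrite ler_norml; apply/andP; split.
  by rewrite lerNl opprB (le_trans h2) // (le_trans (bnd _ _ d0)) // normrN.
by rewrite (le_trans h1) // bnd.
Qed.

Definition hull_length n x : R :=
  lower_length n (psum x) + lower_length n (psum (fun j => - x j)).

Lemma hull_length_upd n i x : (0 < i <= n)%N ->
  `|hull_length n x - hull_length n (upd x i 0)| <=
  2 * `|x i| * Num.min 1 (6 * outer_maxsum n i (upd x i 0)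
                      + `|x i| / (dist_to_end n i)%:R).
Proof.
move=> i1n; have h1 := lower_length_upd x i1n.
have := lower_length_upd (fun j => - x j) i1n.
have -> : upd (fun j => - x j) i 0 = fun j => - upd x i 0 j.
  by apply/funext => j; rewrite /upd; case: eqP => _; rewrite ?oppr0.
rewrite outer_maxsumN normrN => h2.
rewrite /hull_length opprD addrACA; apply: le_trans (ler_normD _ _) _.
lra.
Qed.

(** With a = |x i|, the minimum of 1 and a / r is at most 2 q for q = a / (a + r), as one sees by
    comparing a with r. Then (6 Z + 2 q)^2 <= 72 Z^2 + 8 q^2, and the factor (2 a)^2 turns 72 and 8
    into 288 and 32. The smooth q will telescope in [sum_sqr_ratio]. *)
Lemma sqr_hull_length_upd n i x : (0 < i <= n)%N ->
  (hull_length n x - hull_length n (upd x i 0)) ^+ 2 <=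
  288 * (x i ^+ 2 * outer_maxsum n i (upd x i 0) ^+ 2)
  + 32 * (x i ^+ 4 / (`|x i| + (dist_to_end n i)%:R) ^+ 2).
Proof.
move=> i1n; have := hull_length_upd x i1n.
set d := _ - _; set Z := outer_maxsum _ _ _; set r : R := (dist_to_end n i)%:R.
have r0 : 0 < r by rewrite ltr0n /dist_to_end; lia.
have Z0 : 0 <= Z by exact: maxsum_ge0.
set a := `|x i|; have a0 : 0 <= a by exact: normr_ge0.
have -> : x i ^+ 2 = a ^+ 2 by rewrite /a real_normK ?num_real.
have -> : x i ^+ 4 = a ^+ 2 * a ^+ 2 by rewrite /a real_normK ?num_real // -exprD.
rewrite -[d ^+ 2]real_normK ?num_real //.
move: (normr_ge0 d); set e := `|d| => e0 h.
set q := a / (a + r).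
have q0 : 0 <= q by rewrite divr_ge0 // addr_ge0 // ltW.
have -> : a ^+ 2 * a ^+ 2 / (a + r) ^+ 2 = a ^+ 2 * q ^+ 2.
  by rewrite /q; field; rewrite gt_eqF //; lra.
have hm : Num.min 1 (6 * Z + a / r) <= 6 * Z + 2 * q.
  have qE : q * (a + r) = a by rewrite /q divfK // gt_eqF //; lra.
  have [ar|ra] := leP r a.
    rewrite ge_min; apply/orP; left.
    suff : 1 <= 2 * q by lra.
    rewrite /q mulrA ler_pdivlMr; lra.
  rewrite ge_min; apply/orP; right; rewrite lerD2l.
  rewrite ler_pdivrMr //; nra.
have {h} : e <= 2 * a * (6 * Z + 2 * q).
  by apply: le_trans h _; rewrite ler_wpM2l // mulr_ge0.
rewrite -(ler_pXn2r (n := 2)) ?nnegrE //; last first.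
  by rewrite !mulr_ge0 // addr_ge0 // mulr_ge0.
move=> /le_trans; apply; rewrite exprMn.
have : 0 <= a ^+ 2 * (6 * Z - 2 * q) ^+ 2 by rewrite mulr_ge0 // sqr_ge0.
lra.
Qed.

(* The pathwise form of Doob's maximal inequality in L^2. *)
Definition doob_gap t n : R := runmax t n ^+ 2 / 2 - runmax t n * t n.

(** Equality holds unless a new maximum is set, and then the two sides differ by half of
    [(runmax t n - t n.+1) ^+ 2]. The subtracted product is the increment of a martingale transform,
    of mean 0 for a centred walk. *)
Lemma doob_gapS t n : doob_gap t n.+1 <= doob_gap t n - runmax t n * (t n.+1 - t n).
Proof.
rewrite /doob_gap /=; have := sqr_ge0 (runmax t n - t n.+1).
by have [h|h] := leP (runmax t n) (t n.+1); set m := runmax t n; lra.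
Qed.

(** The two sides differ by the square of [runmax t n - 2 * t n]; 4 is Doob's constant in L^2. *)
Lemma runmax_doob t n : runmax t n ^+ 2 <= 4 * (doob_gap t n + t n ^+ 2).
Proof.
rewrite /doob_gap; have := sqr_ge0 (runmax t n / 2 - t n).
set m := runmax t n; lra.
Qed.

Lemma sqr_maxsum w n x : maxsum w n x ^+ 2 <=
  2 * runmax (psum (fun j => w j * x j)) n ^+ 2
  + 2 * runmax (psum (fun j => - w j * x j)) n ^+ 2.
Proof.
rewrite /maxsum; set a := runmax _ _; set b := runmax _ _.
have := sqr_ge0 (a - b); lra.
Qed.

Lemma sum_sqr_weight r n : (0 < r)%N -> \sum_(1 <= j < n.+1) weight r j ^+ 2 <= 2 / r%:R.
Proof.
move=> r0; have r0' : 0 < r%:R :> R by rewrite ltr0n.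
(* Up to r all terms are 1 / r^2; beyond, (k + 1)^(-2) <= 1/k - 1/(k + 1) telescopes. Both formulas
   equal 1/r at k = r. *)
have main k : \sum_(1 <= j < k.+1) weight r j ^+ 2 <=
    if (k <= r)%N then k%:R / r%:R ^+ 2 else 2 / r%:R - k%:R^-1.
  elim: k => [|k IH]; first by rewrite big_nil mul0r.
  rewrite big_nat_recr //=; apply: le_trans (lerD IH (lexx _)) _.
  rewrite /weight; have [kr|rk] := ltnP k r.
    by rewrite (ltnW kr) (maxn_idPl kr) -natr1 exprVn mulrDl mul1r.
  rewrite (maxn_idPr _); last by lia.
  have k0 : 0 < k%:R :> R by rewrite ltr0n; lia.
  have -> : (if (k <= r)%N then k%:R / r%:R ^+ 2 else 2 / r%:R - k%:R^-1)
      = 2 / r%:R - k%:R^-1 :> R.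
    case: leqP => // kr; have -> : k = r by lia.
    by field; rewrite gt_eqF.
  rewrite -[k.+1%:R]natr1 -subr_ge0.
  have -> : 2 / r%:R - (k%:R + 1)^-1 - (2 / r%:R - k%:R^-1 + (k%:R + 1)^-1 ^+ 2)
    = (k%:R * (k%:R + 1) ^+ 2)^-1 :> R.
    by field; rewrite !gt_eqF //; lra.
  by rewrite invr_ge0 mulr_ge0 ?sqr_ge0 // ltW.
apply: le_trans (main n) _; case: leqP => nr.
  have : n%:R <= r%:R :> R by rewrite ler_nat.
  rewrite ler_pdivrMr ?exprn_gt0 // expr2 mulrA divfK ?gt_eqF //; lra.
by rewrite gerBl invr_ge0 ler0n.
Qed.

(** Telescoping: from n to n + 1 the right-hand side grows by a^2 / ((a + n) (a + n + 1)), which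
    exceeds the new term. The case a = 0 is separate because a + n may then vanish. *)
Lemma sum_sqr_ratio (a : R) n : 0 <= a ->
  \sum_(1 <= i < n.+1) a ^+ 2 / (a + i%:R) ^+ 2 <= a * n%:R / (a + n%:R).
Proof.
rewrite le_eqVlt => /orP[/eqP<-|a0].
  by rewrite !mul0r big1 // => i _; rewrite expr0n mul0r.
elim: n => [|n IH]; first by rewrite big_nil mulr0 mul0r.
rewrite big_nat_recr //= (le_trans (lerD IH (lexx _))) //.
have n0 : 0 <= n%:R :> R by rewrite ler0n.
rewrite -natr1 -subr_ge0.
have -> : a * (n%:R + 1) / (a + (n%:R + 1))
   - (a * n%:R / (a + n%:R) + a ^+ 2 / (a + (n%:R + 1)) ^+ 2)
   = a ^+ 2 / ((a + n%:R) * (a + (n%:R + 1)) ^+ 2).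
  by field; rewrite !gt_eqF //; lra.
by rewrite divr_ge0 ?sqr_ge0 // mulr_ge0 ?sqr_ge0 //; lra.
Qed.

(** The value at the minimum of i and n + 1 - i is one of the two values, hence at most their sum,
    and reversing the order of summation makes the two sums equal. *)
Lemma sum_dist_to_end (f : nat -> R) n : (forall i, 0 <= f i) ->
  \sum_(1 <= i < n.+1) f (dist_to_end n i) <= 2 * \sum_(1 <= i < n.+1) f i.
Proof.
move=> f0; rewrite mulr_natl mulr2n [X in _ <= _ + X]big_nat_rev -big_split /=.
rewrite big_nat [leRHS]big_nat; apply: ler_sum => i ?.
rewrite add1n subSS /dist_to_end /minn; case: ifP => _; first by rewrite lerDl.
by rewrite lerDr.
Qed.

End maximal.

(** * The perimeter of the hull of a graph *)

Section hull_perimeter.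
Local Open Scope convex_scope.
Context {R : realType}.
Implicit Types (s : nat -> R) (x y z : plane R).

Lemma conv_fst x y (t : {i01 R}) :
  (x <| t |> y).1 = t%:num * x.1 + (1 - t%:num) * y.1.
Proof. by []. Qed.

Lemma conv_snd x y (t : {i01 R}) :
  (x <| t |> y).2 = t%:num * x.2 + (1 - t%:num) * y.2.
Proof. by []. Qed.

Lemma plane_eqP x y : x.1 = y.1 -> x.2 = y.2 -> x = y.
Proof. by case: x y => [x1 x2] [y1 y2] /= -> ->. Qed.

Lemma convex_set_half_plane (a b c : R) :
  @convex_set R (R^o * R^o)%type [set z : plane R | 0 <= a * z.1 + b * z.2 + c].
Proof.
move=> x y t /[!inE] /= xA yA.
have t0 : 0 <= t%:num by [].
have t1 : t%:num <= 1 by [].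
suff : 0 <= a * (t%:num * x.1 + (1 - t%:num) * y.1)
             + b * (t%:num * x.2 + (1 - t%:num) * y.2) + c by [].
have -> : a * (t%:num * x.1 + (1 - t%:num) * y.1)
             + b * (t%:num * x.2 + (1 - t%:num) * y.2) + c =
    t%:num * (a * x.1 + b * x.2 + c) + (1 - t%:num) * (a * y.1 + b * y.2 + c).
  by ring.
by rewrite addr_ge0 // mulr_ge0 // subr_ge0.
Qed.

Lemma convex_hull_sub (A B : set (plane R)) :
  @convex_set R (R^o * R^o)%type B -> A `<=` B -> convex_hull A `<=` B.
Proof. exact: smallest_sub. Qed.

Lemma convex_hull_conv (A : set (plane R)) x y (t : {i01 R}) :
  convex_hull A x -> convex_hull A y -> convex_hull A (x <| t |> y).
Proof.
move=> Ax Ay B [cB AB]; apply: set_mem; apply: (cB); apply: mem_set.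
  exact: (Ax B (conj cB AB)).
exact: (Ay B (conj cB AB)).
Qed.

(* Removing an extreme point from a convex set leaves a convex set. *)
Lemma extreme_convex_hull (A : set (plane R)) z :
  extreme_point (convex_hull A) z -> A z.
Proof.
move=> [Kz ext]; apply: contrapT => nAz.
have : convex_hull A `<=` [set x | convex_hull A x /\ x <> z].
  apply: convex_hull_sub; last first.
    by move=> x Ax; split; [exact: sub_gen_smallest|move=> xz; rewrite -xz in nAz].
  apply/convex_setW => x y /set_mem[Kx xz] /set_mem[Ky yz] t t0 t1.
  apply: mem_set; split; first exact: convex_hull_conv.
  by move=> /esym e; have [] := ext _ _ t Kx Ky t0 t1 e.
by move=> /(_ z Kz)[].
Qed.

Definition pt s j : plane R := (j%:R, s j).

Definition graph_points s n : set (plane R) := [set pt s j | j in [set j | (j <= n)%N]].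

Lemma pt_inj s : injective (pt s).
Proof. by move=> i j [/eqP]; rewrite eqr_nat => /eqP. Qed.

Lemma hull_pt s n j : (j <= n)%N -> convex_hull (graph_points s n) (pt s j).
Proof. by move=> jn; apply: sub_gen_smallest; exists j. Qed.

Lemma hull_half_plane s n (a b c : R) :
  (forall l, (l <= n)%N -> 0 <= a * l%:R + b * s l + c) ->
  forall z, convex_hull (graph_points s n) z -> 0 <= a * z.1 + b * z.2 + c.
Proof.
move=> h; apply: (convex_hull_sub (@convex_set_half_plane a b c)).
by move=> _ [l ln <-]; exact: h.
Qed.

(* On the supporting line the points lie on one side of the j-th one, in the
   direction e; adding a large multiple M of the support functional turns this into
   a second half-plane containing the hull. *)
Lemma extreme_of_support s n (a b c e : R) j : (j <= n)%N -> b != 0 -> e != 0 ->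
  (forall l, (l <= n)%N -> 0 <= a * l%:R + b * s l + c) ->
  a * j%:R + b * s j + c = 0 ->
  (forall l, (l <= n)%N -> a * l%:R + b * s l + c = 0 -> 0 <= e * (l%:R - j%:R)) ->
  extreme_point (convex_hull (graph_points s n)) (pt s j).
Proof.
move=> jn b0 e0 g_ge gj h; split; first exact: hull_pt.
have [M M0 hM] : exists2 M : R, 0 <= M & forall l, (l <= n)%N ->
    0 <= e * (l%:R - j%:R) + M * (a * l%:R + b * s l + c).
  have : forall m, (m <= n.+1)%N -> exists2 M : R, 0 <= M & forall l, (l < m)%N ->
      0 <= e * (l%:R - j%:R) + M * (a * l%:R + b * s l + c).
    elim=> [_|m IH mn]; first by exists 0.
    have [M M0 hM] := IH (ltnW mn).
    have gm := g_ge m mn; have hm := h m mn.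
    set g := a * m%:R + b * s m + c in gm hm.
    have [g0|gn0] := eqVneq g 0.
      exists M => // l; rewrite ltnS leq_eqVlt => /orP[/eqP->|]; last exact: hM.
      by rewrite -/g g0 mulr0 addr0 hm.
    have gp : 0 < g by rewrite lt_neqAle eq_sym gn0.
    (* A point strictly off the supporting line has g > 0, so a large enough multiple of g outweighs
       its term in e; enlarging M does no harm to the earlier points. *)
    exists (M + `|e * (m%:R - j%:R)| / g) => [|l]; first by rewrite addr_ge0 // divr_ge0.
    rewrite ltnS leq_eqVlt => /orP[/eqP->|lm].
      rewrite -/g mulrDl divfK // addrCA addr_ge0 ?mulr_ge0 //.
      by have := ler_norm (- (e * (m%:R - j%:R))); rewrite normrN; lra.
    rewrite mulrDl addrA addr_ge0 ?hM // mulr_ge0 ?divr_ge0 // g_ge //; lia.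
  by move=> /(_ n.+1 (leqnn _))[M M0 hM]; exists M => // l ln; apply: hM.
move=> x y t Kx Ky t0 t1 E.
have {M0 hM} f_ge z : convex_hull (graph_points s n) z ->
    0 <= e * (z.1 - j%:R) + M * (a * z.1 + b * z.2 + c).
  move=> Kz; have : 0 <= (e + M * a) * z.1 + (M * b) * z.2 + (M * c - e * j%:R).
    by apply: hull_half_plane Kz => l ln; have := hM l ln; lra.
  lra.
have gx := hull_half_plane g_ge Kx; have gy := hull_half_plane g_ge Ky.
have fx := f_ge _ Kx; have fy := f_ge _ Ky.
have E1 : j%:R = t%:num * x.1 + (1 - t%:num) * y.1 by rewrite -conv_fst -E.
have E2 : s j = t%:num * x.2 + (1 - t%:num) * y.2 by rewrite -conv_snd -E.
move: (t%:num) t0 t1 E1 E2 => u u0 u1 E1 E2.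
(* The claim is used for x and, after exchanging u with 1 - u, for y. In it, two nonnegative numbers
   with a vanishing positive combination both vanish: first for the support functional, then for the
   direction e. *)
suff H (z1 z2 w1 w2 v : R) : 0 < v -> v < 1 -> j%:R = v * z1 + (1 - v) * w1 ->
    s j = v * z2 + (1 - v) * w2 ->
    0 <= a * z1 + b * z2 + c -> 0 <= a * w1 + b * w2 + c ->
    0 <= e * (z1 - j%:R) + M * (a * z1 + b * z2 + c) ->
    0 <= e * (w1 - j%:R) + M * (a * w1 + b * w2 + c) -> z1 = j%:R /\ z2 = s j.
  split; apply: plane_eqP => /=; [
    exact: (H _ _ _ _ _ u0 u1 E1 E2 gx gy fx fy).1|
    exact: (H _ _ _ _ _ u0 u1 E1 E2 gx gy fx fy).2|..].
    by apply: (H _ y.2 x.1 x.2 (1 - u) _ _ _ _ gy gx fy fx).1; lra.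
  by apply: (H y.1 _ x.1 x.2 (1 - u) _ _ _ _ gy gx fy fx).2; lra.
clear -b0 e0 gj => v0 v1 E1 E2 gz gw fz fw.
have gz0 : a * z1 + b * z2 + c = 0.
  have : v * (a * z1 + b * z2 + c) + (1 - v) * (a * w1 + b * w2 + c) = 0.
    by rewrite -gj E1 E2; ring.
  have : 0 <= (1 - v) * (a * w1 + b * w2 + c) by rewrite mulr_ge0 //; lra.
  have : 0 <= v * (a * z1 + b * z2 + c) by rewrite mulr_ge0 //; lra.
  move=> p q r; have : v * (a * z1 + b * z2 + c) = 0 by lra.
  by move/eqP; rewrite mulf_eq0 gt_eqF //= => /eqP.
have gw0 : a * w1 + b * w2 + c = 0.
  have : v * (a * z1 + b * z2 + c) + (1 - v) * (a * w1 + b * w2 + c) = 0.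
    by rewrite -gj E1 E2; ring.
  rewrite gz0 mulr0 add0r => /eqP; rewrite mulf_eq0 subr_eq0 gt_eqF //=.
  by move/eqP.
move: fz fw; rewrite gz0 gw0 !mulr0 !addr0 => fz fw.
have ez : e * (z1 - j%:R) = 0.
  have : v * (e * (z1 - j%:R)) + (1 - v) * (e * (w1 - j%:R)) = 0.
    have -> : v * (e * (z1 - j%:R)) + (1 - v) * (e * (w1 - j%:R)) =
        e * (v * z1 + (1 - v) * w1 - j%:R) by ring.
    by rewrite -E1 subrr mulr0.
  have : 0 <= (1 - v) * (e * (w1 - j%:R)) by rewrite mulr_ge0 //; lra.
  have : 0 <= v * (e * (z1 - j%:R)) by rewrite mulr_ge0 //; lra.
  move=> p q r; have : v * (e * (z1 - j%:R)) = 0 by lra.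
  by move/eqP; rewrite mulf_eq0 gt_eqF //= => /eqP.
have z1E : z1 = j%:R.
  by move/eqP: ez; rewrite mulf_eq0 (negbTE e0) /= subr_eq0 => /eqP.
split=> //; apply: (mulfI b0).
by move: gz0; rewrite z1E; lra.
Qed.

(** Collinear intermediate points are no vertices of the hull; this matches the maximality built
    into [lower_side]. *)
Lemma extreme_not_between s n l m h : (l <= n)%N -> (h <= n)%N -> (l < m < h)%N ->
  extreme_point (convex_hull (graph_points s n)) (pt s m) ->
  (s m - s l) * (h%:R - l%:R) = (s h - s l) * (m%:R - l%:R) -> False.
Proof.
move=> ln hn /andP[lm mh] [Km ext] E.
have lm' : l%:R < m%:R :> R by rewrite ltr_nat.
have mh' : m%:R < h%:R :> R by rewrite ltr_nat.
have d0 : 0 < h%:R - l%:R :> R by lra.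
pose u : R := (h%:R - m%:R) / (h%:R - l%:R).
have ud : u * (h%:R - l%:R) = h%:R - m%:R by rewrite /u divfK // gt_eqF.
have u0 : 0 < u by rewrite divr_gt0 //; lra.
have u1 : u < 1 by rewrite ltr_pdivrMr //; lra.
have [] := ext _ _ (Itv01 (ltW u0) (ltW u1)) (@hull_pt s n l ln) (@hull_pt s n h hn) u0 u1.
  apply: plane_eqP; rewrite ?conv_fst ?conv_snd /=; first lra.
  apply: (mulIf (lt0r_neq0 d0)).
  suff : (s m - s l) * (h%:R - l%:R) = (s h - s l) * (h%:R - l%:R) - (s h - s l) * (u * (h%:R - l%:R)).
    lra.
  by rewrite ud E; ring.
by move/pt_inj => e _; rewrite e ltnn in lm.
Qed.

(** For j < k and c = 1 the hull lies above the chord, which is a side run from left to right; for c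
    = -1 it lies below, and the side runs from right to left. The sign lets one proof serve both. *)
Definition signed_side s n (c : R) j k : Prop :=
  [/\ extreme_point (convex_hull (graph_points s n)) (pt s j),
      extreme_point (convex_hull (graph_points s n)) (pt s k) &
      forall z, convex_hull (graph_points s n) z ->
        0 <= c * ((k%:R - j%:R) * (z.2 - s j) - (s k - s j) * (z.1 - j%:R))].

(** From left to right, a point on the line outside [j, k] would put j or k strictly between two
    collinear points. Conversely, the line of the chord supports the hull, and its ends are the
    first and last points on it: directions 1 and -1 in [extreme_of_support]. *)
Lemma signed_sideP s n (c : R) j k : (j < k)%N -> (k <= n)%N -> c != 0 ->
  signed_side s n c j k <-> lower_side n (fun l => c * s l) j k.
Proof.
move=> jk kn c0; have jn : (j <= n)%N by lia.
have d0 : 0 < k%:R - j%:R :> R by rewrite subr_gt0 ltr_nat.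
set s' := fun l => c * s l; have E := chordM s' jk.
set q := chord s' j k in E; split.
  move=> [extj extk left].
  have col l : s' l - s' j = q * (l%:R - j%:R) ->
      (s l - s j) * (k%:R - j%:R) = (s k - s j) * (l%:R - j%:R).
    rewrite /s' => e; apply: (mulfI c0).
    have -> : c * ((s l - s j) * (k%:R - j%:R)) = (c * s l - c * s j) * (k%:R - j%:R) by ring.
    rewrite e mulrAC E; rewrite /s'; ring.
  apply: (lower_sideI (s := q)) => //.
    move=> l ln; rewrite -(pmulr_rge0 _ d0).
    have := left _ (@hull_pt s n l ln); rewrite /=.
    have -> : c * ((k%:R - j%:R) * (s l - s j) - (s k - s j) * (l%:R - j%:R)) =
      (k%:R - j%:R) * (s' l - s' j) - (s' k - s' j) * (l%:R - j%:R) by rewrite /s'; ring.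
    by rewrite -E; congr (_ <= _); ring.
  move=> l ln /col {}E; apply/andP; split; rewrite leqNgt; apply/negP => lt.
    by apply: (@extreme_not_between s n l j k) => //; [lia|lra].
  by apply: (@extreme_not_between s n j k l) => //; lia.
move=> L.
have above l : (l <= n)%N -> 0 <= (- q) * l%:R + c * s l + (q * j%:R - s' j).
  by move=> ln; have := lower_side_above L ln; rewrite -/q /s'; lra.
split.
- apply: (@extreme_of_support _ _ (- q) c (q * j%:R - s' j) 1) => //.
    by rewrite /s'; ring.
  move=> l ln e; have {}e : s' l - s' j = q * (l%:R - j%:R).
    by move: e; rewrite /s'; lra.
  have /andP[jl _] := lower_side_on L ln e.
  by rewrite mul1r subr_ge0 ler_nat.
- apply: (@extreme_of_support _ _ (- q) c (q * j%:R - s' j) (-1)) => //.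
  + by rewrite /s' in E *; lra.
  move=> l ln e; have {}e : s' l - s' j = q * (l%:R - j%:R).
    by move: e; rewrite /s'; lra.
  have /andP[_ lk] := lower_side_on L ln e.
  by rewrite mulN1r oppr_ge0 subr_le0 ler_nat.
- move=> z /(hull_half_plane above) h.
  have -> : c * ((k%:R - j%:R) * (z.2 - s j) - (s k - s j) * (z.1 - j%:R)) =
      (k%:R - j%:R) * (c * z.2 - s' j) - (s' k - s' j) * (z.1 - j%:R) by rewrite /s'; ring.
  rewrite -E; have := mulr_ge0 (ltW d0) h; lra.
Qed.

(** The abscissas are distinct, so no side is vertical. Counterclockwise sides run rightwards along
    the minorant and leftwards along the majorant, the opposite of the minorant of [- s]; for a hull
    that is a segment both orientations occur. *)
Lemma sides_hullE s n :
  sides (convex_hull (graph_points s n)) =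
  (fun e : 'I_n.+1 * 'I_n.+1 => (pt s e.1, pt s e.2)) @`
  [set e : 'I_n.+1 * 'I_n.+1 | lower_side n s e.1 e.2 || lower_side n (fun l => - s l) e.2 e.1].
Proof.
have one0 : (1 : R) != 0 by exact: oner_neq0.
have m1 : (-1 : R) != 0 by rewrite oppr_eq0.
have sE1 : (fun l => 1 * s l) = s by apply/funext => l; rewrite mul1r.
have sE2 : (fun l => -1 * s l) = (fun l => - s l) by apply/funext => l; rewrite mulN1r.
apply/seteqP; split.
  move=> [p q] [/= extp extq pq left].
  have [j /= jn ej] := extreme_convex_hull extp.
  have [k /= kn ek] := extreme_convex_hull extq.
  subst p q.
  exists (Ordinal (jn : (j < n.+1)%N), Ordinal (kn : (k < n.+1)%N)) => //=.
  have [jk|kj|jk] := ltngtP j k; last by rewrite jk in pq.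
    apply/orP; left; rewrite -[in lower_side _ _]sE1.
    apply/(signed_sideP _ jk kn one0); split=> // z /left; rewrite /left_half_plane /=.
    by rewrite mul1r.
  apply/orP; right; rewrite -sE2.
  apply/(signed_sideP _ kj jn m1); split=> // z /left; rewrite /left_half_plane /=.
  by move=> h; lra.
move=> _ [[j k] /= /orP[] L <-]; have jk := lower_side_lt L; have kn := lower_side_le L.
  move: L; rewrite -[in lower_side _ _]sE1 => /(signed_sideP _ jk kn one0)[e1 e2 h].
  split=> //=; first by move/pt_inj => e; rewrite e ltnn in jk.
  by move=> z /h; rewrite mul1r.
move: L; rewrite -sE2 => /(signed_sideP _ jk kn m1)[e1 e2 h].
split=> //=; first by move/pt_inj => e; rewrite e ltnn in jk.
by move=> z /h; rewrite /left_half_plane /= => h'; lra.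
Qed.

Lemma perimeter_hull s n :
  perimeter (convex_hull (graph_points s n)) =
  lower_length n s + lower_length n (fun l => - s l).
Proof.
rewrite /perimeter sides_hullE fsbig_image /=; last first.
  move=> [a b] [a' b'] _ _ E.
  have /pt_inj/val_inj /= -> := congr1 fst E.
  by have /pt_inj/val_inj /= -> := congr1 snd E.
pose P (e : 'I_n.+1 * 'I_n.+1) :=
  lower_side n s e.1 e.2 || lower_side n (fun l => - s l) e.2 e.1.
rewrite -[LHS](@bigfs _ _ _ _ (index_enum _) P) ?index_enum_uniq //; last first.
  by move=> e _; rewrite mem_index_enum.
rewrite (bigID (fun e : 'I_n.+1 * 'I_n.+1 => lower_side n s e.1 e.2)) /=; congr (_ + _).
  apply: eq_big => [e|e _].
    by rewrite /P; case: (lower_side n s e.1 e.2); rewrite ?andbF.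
  by rewrite /edist /=; congr Num.sqrt; ring.
rewrite /lower_length (reindex (fun e : 'I_n.+1 * 'I_n.+1 => (e.2, e.1))) /=; last first.
  by exists (fun e => (e.2, e.1)) => -[].
apply: eq_big => [e|e _].
  (* No pair is counted twice: the two kinds of sides order their endpoints oppositely. *)
  rewrite /P; case L : (lower_side n s e.2 e.1) => /=; last by rewrite andbT.
  by apply/esym/negbTE/negP => /lower_side_lt; have := lower_side_lt L; lia.
by rewrite /edist /=; congr Num.sqrt; ring.
Qed.

End hull_perimeter.

(** * Functionals of a sequence of independent variables *)

Section functionals.
Context {R : realType}.
Implicit Types (F G : (nat -> R) -> R) (x : nat -> R) (i j k n N : nat).

(* Measurability of a functional of a sequence, phrased without a sigma-algebra
   on sequences: substituting measurable coordinates gives a measurable map. *)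
Definition fmeas F : Prop := forall d (W : measurableType d) (y : nat -> W -> R),
  (forall i, measurable_fun setT (y i)) -> measurable_fun setT (fun w => F (fun i => y i w)).

Definition quad N x : R := 1 + \sum_(j < N) x j ^+ 2.

(** Domination by finitely many squared coordinates gives integrability from second moments alone,
    and the class is stable under all operations used below. *)
Definition quad_growth F : Prop :=
  fmeas F /\ exists N C, forall x, `|F x| <= C * quad N x.

(** The square of [F] is bounded, so that [F] is square integrable and products of two such
    functionals have quadratic growth. *)
Definition linear_growth F : Prop :=
  fmeas F /\ exists N C, forall x, F x ^+ 2 <= C * quad N x.

Lemma quad_ge1 N x : 1 <= quad N x.
Proof. by rewrite /quad lerDl sumr_ge0 // => j _; exact: sqr_ge0. Qed.

Lemma quad_ge0 N x : 0 <= quad N x.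
Proof. by rewrite (le_trans ler01) ?quad_ge1. Qed.

Lemma le_quad N N' x : (N <= N')%N -> quad N x <= quad N' x.
Proof.
move=> NN; rewrite /quad lerD2l -!(big_mkord xpredT (fun j => x j ^+ 2)).
rewrite (big_cat_nat (n := N) (p := N')) //= lerDl.
by rewrite sumr_ge0 // => j _; exact: sqr_ge0.
Qed.

Lemma quad_upd N x i u : quad N (upd x i u) <= quad N x + u ^+ 2.
Proof.
rewrite /quad -addrA lerD2l; have [iN|Ni] := ltnP i N.
  rewrite (bigD1 (Ordinal iN)) //= [X in _ <= X + _](bigD1 (Ordinal iN)) //=.
  have : \sum_(j < N | j != Ordinal iN) upd x i u j ^+ 2 <=
         \sum_(j < N | j != Ordinal iN) x j ^+ 2.
    rewrite ler_sum // => j /eqP ji; rewrite /upd.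
    by case: eqP => // ji'; case: ji; apply: val_inj.
  by have := sqr_ge0 (x i); rewrite [upd x i u i]/upd eqxx; lra.
rewrite -[leLHS]addr0 lerD ?sqr_ge0 // ler_sum // => j _.
by rewrite /upd; case: eqP => // ji; have := ltn_ord j; lia.
Qed.

Lemma quad_bound F : (exists N C, forall x, F x <= C * quad N x) ->
  exists M C, 0 <= C /\ forall N, (M <= N)%N -> forall x, F x <= C * quad N x.
Proof.
move=> [M [C h]]; exists M, `|C|; split=> // N MN x; apply: le_trans (h x) _.
apply: (@le_trans _ _ (`|C| * quad M x)).
  by rewrite ler_wpM2r ?quad_ge0 // ler_norm.
by rewrite ler_wpM2l // le_quad.
Qed.

Lemma fmeas_comp F (f : R -> R) : measurable_fun setT f -> fmeas F -> fmeas (fun x => f (F x)).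
Proof. by move=> mf mF d W y my; apply: measurableT_comp => //; exact: mF. Qed.

Lemma fmeas_cst (c : R) : fmeas (fun=> c).
Proof. by move=> d W y my; exact: measurable_cst. Qed.

Lemma fmeas_coord j : fmeas (fun x => x j).
Proof. by move=> d W y my; exact: my. Qed.

Lemma fmeasD F G : fmeas F -> fmeas G -> fmeas (fun x => F x + G x).
Proof. by move=> mF mG d W y my; apply: measurable_funD; [exact: mF|exact: mG]. Qed.

Lemma fmeasM F G : fmeas F -> fmeas G -> fmeas (fun x => F x * G x).
Proof. by move=> mF mG d W y my; apply: measurable_funM; [exact: mF|exact: mG]. Qed.

Lemma fmeasX F n : fmeas F -> fmeas (fun x => F x ^+ n).
Proof. by move=> mF d W y my; apply: measurable_funX; exact: mF. Qed.

Lemma fmeas_max F G : fmeas F -> fmeas G -> fmeas (fun x => Num.max (F x) (G x)).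
Proof. by move=> mF mG d W y my; apply: measurable_maxr; [exact: mF|exact: mG]. Qed.

Lemma fmeas_subst F (h : nat -> (nat -> R) -> R) :
  fmeas F -> (forall j, fmeas (h j)) -> fmeas (fun x => F (fun j => h j x)).
Proof. by move=> mF mh d W y my; apply: (mF _ _ (fun j w => h j (y^~ w))) => j; exact: mh. Qed.

Lemma fmeas_upd F i (u : R) : fmeas F -> fmeas (fun x => F (upd x i u)).
Proof.
move=> mF; apply: (fmeas_subst (h := fun j x => upd x i u j) mF) => j.
by rewrite /upd; case: eqP => _; [exact: fmeas_cst|exact: fmeas_coord].
Qed.

Lemma linear_quad F : linear_growth F -> quad_growth F.
Proof.
move=> [mF [N [C h]]]; split=> //; exists N, (1 + C) => x.
have := h x; have := quad_ge1 N x; have := sqr_ge0 (`|F x| - 1).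
have := sqr_ge0 `|F x|.
by rewrite -(real_normK (num_real (F x))); lra.
Qed.

Lemma linear_sqr F : linear_growth F -> quad_growth (fun x => F x ^+ 2).
Proof.
move=> [mF [N [C h]]]; split; first exact: fmeasX.
by exists N, C => x; rewrite ger0_norm ?sqr_ge0.
Qed.

Lemma quad_growth_dom F G : fmeas F -> quad_growth G -> (forall x, `|F x| <= `|G x|) ->
  quad_growth F.
Proof.
by move=> mF [_ [N [C h]]] FG; split=> //; exists N, C => x; apply: le_trans (h x).
Qed.

Lemma linear_growth_dom F G : fmeas F -> linear_growth G -> (forall x, `|F x| <= `|G x|) ->
  linear_growth F.
Proof.
move=> mF [_ [N [C h]]] FG; split=> //; exists N, C => x; apply: le_trans (h x).
by rewrite -(real_normK (num_real (F x))) -(real_normK (num_real (G x))) lerXn2r ?nnegrE.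
Qed.

Lemma quad_growthD F G : quad_growth F -> quad_growth G -> quad_growth (fun x => F x + G x).
Proof.
move=> [mF /(quad_bound (F := fun x => `|F x|))[M [C [C0 h]]]].
move=> [mG /(quad_bound (F := fun x => `|G x|))[M' [C' [C'0 h']]]].
split; first exact: fmeasD.
exists (maxn M M'), (C + C') => x; rewrite mulrDl; apply: le_trans (ler_normD _ _) _.
by rewrite lerD ?h ?h' // ?leq_maxl ?leq_maxr.
Qed.

Lemma quad_growth_cst (c : R) : quad_growth (fun=> c).
Proof.
split; first exact: fmeas_cst.
by exists 0%N, `|c| => x; rewrite /quad big_ord0 addr0 mulr1.
Qed.

Lemma quad_growthZ c F : quad_growth F -> quad_growth (fun x => c * F x).
Proof.
move=> [mF [N [C h]]]; split; first exact: fmeasM (fmeas_cst c) mF.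
by exists N, (`|c| * C) => x; rewrite normrM -mulrA ler_wpM2l.
Qed.

Lemma quad_growthB F G : quad_growth F -> quad_growth G -> quad_growth (fun x => F x - G x).
Proof.
move=> qF qG; rewrite (_ : (fun x => _) = (fun x => F x + -1 * G x)).
  exact: quad_growthD qF (quad_growthZ (-1) qG).
by apply/funext => x; rewrite mulN1r.
Qed.

Lemma linear_growthM F G : linear_growth F -> linear_growth G ->
  quad_growth (fun x => F x * G x).
Proof.
move=> lF lG; have mF := lF.1; have mG := lG.1.
apply: (@quad_growth_dom _ (fun x => F x ^+ 2 + G x ^+ 2)); first exact: fmeasM.
  by apply: quad_growthD; exact: linear_sqr.
move=> x; rewrite [leRHS]ger0_norm ?addr_ge0 ?sqr_ge0 // ler_norml.
have := sqr_ge0 (F x + G x); have := sqr_ge0 (F x - G x).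
by have := sqr_ge0 (F x); have := sqr_ge0 (G x) => *; apply/andP; split; lra.
Qed.

Lemma linear_growth_cst (c : R) : linear_growth (fun=> c).
Proof.
split; first exact: fmeas_cst.
by exists 0%N, (c ^+ 2) => x; rewrite /quad big_ord0 addr0 mulr1.
Qed.

Lemma linear_growth_coord j : linear_growth (fun x => x j).
Proof.
split; first exact: fmeas_coord.
exists j.+1, 1 => x; rewrite mul1r /quad big_ord_recr /= addrA lerDr.
by rewrite addr_ge0 ?sumr_ge0 // => i _; exact: sqr_ge0.
Qed.

Lemma linear_growthD F G : linear_growth F -> linear_growth G ->
  linear_growth (fun x => F x + G x).
Proof.
move=> [mF /(quad_bound (F := fun x => F x ^+ 2))[M [C [C0 h]]]].
move=> [mG /(quad_bound (F := fun x => G x ^+ 2))[M' [C' [C'0 h']]]].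
split; first exact: fmeasD.
exists (maxn M M'), (2 * C + 2 * C') => x.
have := h _ (leq_maxl M M') x; have := h' _ (leq_maxr M M') x.
by have := sqr_ge0 (F x - G x); lra.
Qed.

Lemma linear_growthZ c F : linear_growth F -> linear_growth (fun x => c * F x).
Proof.
move=> [mF [N [C h]]]; split; first exact: fmeasM (fmeas_cst c) mF.
exists N, (c ^+ 2 * C) => x; rewrite exprMn -mulrA ler_wpM2l //.
exact: sqr_ge0.
Qed.

Lemma linear_growthN F : linear_growth F -> linear_growth (fun x => - F x).
Proof.
by move=> /(linear_growthZ (-1)); under [X in linear_growth X]eq_fun do rewrite mulN1r.
Qed.

Lemma linear_growthB F G : linear_growth F -> linear_growth G ->
  linear_growth (fun x => F x - G x).
Proof. by move=> lF lG; exact: linear_growthD lF (linear_growthN lG). Qed.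

Lemma linear_growth_norm F : linear_growth F -> linear_growth (fun x => `|F x|).
Proof.
move=> lF; apply: linear_growth_dom (lF) _ => [|x]; last by rewrite normr_id.
by apply: fmeas_comp lF.1; exact: normr_measurable.
Qed.

Lemma linear_growth_max F G : linear_growth F -> linear_growth G ->
  linear_growth (fun x => Num.max (F x) (G x)).
Proof.
move=> lF lG; have mFG := fmeas_max lF.1 lG.1.
apply: (linear_growth_dom mFG (linear_growthD (linear_growth_norm lF) (linear_growth_norm lG))).
move=> x; rewrite [leRHS]ger0_norm ?addr_ge0 //.
by case: (leP (F x) (G x)) => _; rewrite ?lerDl ?lerDr.
Qed.

Lemma linear_growth_sum (I : Type) (s : seq I) (P : pred I) (H : I -> (nat -> R) -> R) :
  (forall a, P a -> linear_growth (H a)) ->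
  linear_growth (fun x => \sum_(a <- s | P a) H a x).
Proof.
move=> qF; elim: s => [|a s IH].
  by under [X in linear_growth X]eq_fun do rewrite big_nil; exact: linear_growth_cst.
under [X in linear_growth X]eq_fun do rewrite big_cons.
by case Pa : (P a) => //; apply: linear_growthD => //; exact: qF.
Qed.

Lemma linear_growth_upd F i : linear_growth F -> linear_growth (fun x => F (upd x i 0)).
Proof.
move=> [mF [N [C h]]]; split; first exact: fmeas_upd.
exists N, `|C| => x; apply: le_trans (h _) _.
apply: (@le_trans _ _ (`|C| * quad N (upd x i 0))).
  by rewrite ler_wpM2r ?quad_ge0 // ler_norm.
by rewrite ler_wpM2l // (le_trans (quad_upd _ _ _ _)) // expr0n addr0.
Qed.

Lemma linear_growth_psum (h : nat -> (nat -> R) -> R) k : (forall j, linear_growth (h j)) ->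
  linear_growth (fun x => psum (fun j => h j x) k).
Proof. by move=> lh; apply: linear_growth_sum => j _. Qed.

Lemma linear_growth_runmax (h : nat -> (nat -> R) -> R) k : (forall j, linear_growth (h j)) ->
  linear_growth (fun x => runmax (fun j => h j x) k).
Proof.
by move=> lh; elim: k => [|k IH] /=; [exact: linear_growth_cst|exact: linear_growth_max].
Qed.

End functionals.

(** * Integrating out one coordinate *)

Section coordinate_integral.
Context {R : realType} (mu : probability R R).
Hypothesis mu2 : mu.-integrable setT (fun u => (u ^+ 2)%:E).
Implicit Types (F G : (nat -> R) -> R) (x : nat -> R) (i j k n N : nat).

(** For independent coordinates of law [mu] this is the conditional expectation of [F] given all
    coordinates but the i-th. It is again a functional of the sequence, so the operation can be
    iterated. *)
Definition integ i F x : R := \int[mu]_u F (upd x i u).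

Lemma measurable_upd d (W : measurableType d) (y : nat -> W -> R) (v : W -> R) i :
  (forall j, measurable_fun setT (y j)) -> measurable_fun setT v ->
  forall j, measurable_fun setT (fun w => upd (y^~ w) i (v w) j).
Proof. by move=> my mv j; rewrite /upd; case: eqP => _; [exact: mv|exact: my]. Qed.

Lemma integrable_cst_mu (c : R) : mu.-integrable setT (EFin \o cst c).
Proof.
exact: finite_measure_integrable_cst.
Qed.

Lemma integrable_upd F x i : quad_growth F ->
  mu.-integrable setT (EFin \o (fun u => F (upd x i u))).
Proof.
move=> [mF [N [C h]]].
have m : measurable_fun setT (fun u => F (upd x i u)).
  apply: (mF _ _ (fun j u => upd x i u j)).
  by apply: (@measurable_upd _ _ (fun j u => x j) id) => [j|]; [exact: measurable_cst|exact: measurable_id].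
apply: (@le_integrable _ _ _ mu setT measurableT _
  (EFin \o (fun u => `|C| * quad N x + `|C| * u ^+ 2))) => //.
- exact/measurable_EFinP.
- move=> u _ /=; rewrite lee_fin; apply: le_trans (h _) _.
  apply: le_trans (ler_norm _) ; rewrite -mulrDr.
  apply: (@le_trans _ _ (`|C| * quad N (upd x i u))).
    by rewrite ler_wpM2r ?quad_ge0 // ler_norm.
  by rewrite ler_wpM2l // quad_upd.
- have i2 : mu.-integrable setT (EFin \o (fun u => `|C| * u ^+ 2)).
    by rewrite (_ : _ \o _ = (fun u => `|C|%:E * (u ^+ 2)%:E)%E) //; exact: integrableZl.
  exact: (integrableD measurableT (integrable_cst_mu _) i2).
Qed.

Lemma Rintegral_cst_prob (c : R) : \int[mu]_u c = c.
Proof. by rewrite /Rintegral integral_cst // [X in (_ * X)%E]probability_setT mule1. Qed.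

Lemma integ_cst i c x : integ i (fun=> c) x = c.
Proof. exact: Rintegral_cst_prob. Qed.

Lemma integ_le i F G x : quad_growth F -> quad_growth G -> (forall y, F y <= G y) ->
  integ i F x <= integ i G x.
Proof. by move=> qF qG FG; apply: le_Rintegral => //; exact: integrable_upd. Qed.

Lemma integB i F G x : quad_growth F -> quad_growth G ->
  integ i (fun y => F y - G y) x = integ i F x - integ i G x.
Proof. by move=> qF qG; apply: RintegralB => //; exact: integrable_upd. Qed.

Lemma integZ i c F x : quad_growth F -> integ i (fun y => c * F y) x = c * integ i F x.
Proof. by move=> qF; apply: RintegralZl => //; exact: integrable_upd. Qed.

Lemma integMl i H F x : quad_growth F -> (forall y u, H (upd y i u) = H y) ->
  integ i (fun y => H y * F y) x = H x * integ i F x.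
Proof.
move=> qF hH; rewrite /integ; under eq_Rintegral do rewrite hH.
by apply: RintegralZl => //; exact: integrable_upd.
Qed.

Lemma updK x i u v : upd (upd x i u) i v = upd x i v.
Proof. by apply/funext => j; rewrite /upd; case: eqP. Qed.

Lemma upd_same x i : upd x i (x i) = x.
Proof. by apply/funext => j; rewrite /upd; case: eqP => // ->. Qed.

Lemma updC x i j u v : i != j -> upd (upd x i u) j v = upd (upd x j v) i u.
Proof.
move=> ij; apply/funext => l; rewrite /upd; case: (eqVneq l j) => // ->.
by rewrite eq_sym (negbTE ij).
Qed.

Lemma fmeas_integ i F : fmeas F -> fmeas (integ i F).
Proof.
move=> mF d W y my; rewrite /integ /Rintegral.
apply: (measurableT_comp (fine_measurable measurableT)).
pose f (z : W * R) := (F (upd (y^~ z.1) i z.2))%:E.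
have mf : measurable_fun setT f.
  apply/measurable_EFinP; apply: (mF _ _ (fun j (z : W * R) => upd (y^~ z.1) i z.2 j)).
  apply: (@measurable_upd _ _ (fun j (z : W * R) => y j z.1)) => [j|].
    by apply: measurableT_comp => //; exact: measurable_fst.
  exact: measurable_snd.
(* Tonelli's theorem for the positive and the negative part gives measurability in the parameter
   without any integrability. *)
rewrite (_ : (fun w => _) = (fun w => \int[mu]_u f^\+ (w, u) - \int[mu]_u f^\- (w, u))%E); last first.
  apply/funext => w; rewrite integralE; congr (_ - _)%E; apply: eq_integral => u _.
    by rewrite !funeposE.
  by rewrite !funenegE.
apply: emeasurable_funB.
  apply: (measurable_fun_fubini_tonelli_F (m2 := mu) (f^\+)%E) => //.
  exact: measurable_funepos.
apply: (measurable_fun_fubini_tonelli_F (m2 := mu) (f^\-)%E) => //.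
exact: measurable_funeneg.
Qed.

Lemma quad_growth_integ i F : quad_growth F -> quad_growth (integ i F).
Proof.
move=> [mF [N [C h]]]; split; first exact: fmeas_integ.
set s2 : R := \int[mu]_u (u ^+ 2).
exists N, (`|C| + `|C| * s2) => x.
have ib := integrable_upd x i (conj mF (ex_intro _ N (ex_intro _ C h)) : quad_growth F).
apply: le_trans (le_normr_Rintegral measurableT ib) _.
have s20 : 0 <= s2 by apply: Rintegral_ge0 => u _; exact: sqr_ge0.
have ic := integrable_cst_mu (`|C| * quad N x).
have i2 : mu.-integrable setT (EFin \o (fun u => `|C| * u ^+ 2)).
  by rewrite (_ : _ \o _ = (fun u => `|C|%:E * (u ^+ 2)%:E)%E) //; exact: integrableZl.
apply: (@le_trans _ _ (\int[mu]_u (`|C| * quad N x + `|C| * u ^+ 2))).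
  apply: le_Rintegral => //; first exact: integrable_norm.
    exact: (integrableD measurableT ic i2).
  move=> u _; apply: le_trans (h _) _; rewrite -mulrDr.
  apply: (@le_trans _ _ (`|C| * quad N (upd x i u))).
    by rewrite ler_wpM2r ?quad_ge0 // ler_norm.
  by rewrite ler_wpM2l // quad_upd.
rewrite (@RintegralD _ _ _ mu setT (cst (`|C| * quad N x))) //.
rewrite Rintegral_cst_prob RintegralZl // -/s2.
have := quad_ge1 N x; have : 0 <= `|C| * s2 by rewrite mulr_ge0.
move=> p q; rewrite mulrDl lerD2l; nra.
Qed.

(** Jensen's inequality, by integrating the tangent bound F^2 >= 2 c F - c^2 at the mean c. *)
Lemma sqr_integ_le i F x : linear_growth F ->
  integ i F x ^+ 2 <= integ i (fun y => F y ^+ 2) x.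
Proof.
move=> lF; set c := integ i F x.
have q1 := linear_quad lF; have q2 := linear_sqr lF.
have : integ i (fun=> 0) x <= integ i (fun y => F y ^+ 2 - (2 * c * F y - c ^+ 2)) x.
  apply: integ_le; first exact: quad_growth_cst.
    by apply: quad_growthB => //; apply: quad_growthB; [exact: quad_growthZ|exact: quad_growth_cst].
  by move=> y; have := sqr_ge0 (F y - c); lra.
rewrite integ_cst integB //; last first.
  by apply: quad_growthB; [exact: quad_growthZ|exact: quad_growth_cst].
rewrite integB; [|exact: quad_growthZ|exact: quad_growth_cst].
rewrite integZ // integ_cst -/c; lra.
Qed.

Lemma linear_growth_integ i F : linear_growth F -> linear_growth (integ i F).
Proof.
move=> lF; split; first exact: fmeas_integ lF.1.
have [_ [N [C h]]] := quad_growth_integ i (linear_sqr lF).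
exists N, C => x; apply: le_trans (sqr_integ_le _ _ lF) _.
exact: le_trans (ler_norm _) (h x).
Qed.

(** With the other coordinates fixed, [F (upd y i 0)] is a constant, and the mean minimizes the mean
    square distance to constants. *)
Lemma integ_variance_le i F x : linear_growth F ->
  integ i (fun y => F y ^+ 2) x - integ i F x ^+ 2 <=
  integ i (fun y => (F y - F (upd y i 0)) ^+ 2) x.
Proof.
move=> lF; set c := F (upd x i 0).
have q1 := linear_quad lF; have q2 := linear_sqr lF.
have -> : integ i (fun y => (F y - F (upd y i 0)) ^+ 2) x =
    integ i (fun y => F y ^+ 2 - (2 * c * F y - c ^+ 2)) x.
  rewrite /integ; apply: eq_Rintegral => u _; rewrite updK -/c; ring.
rewrite integB //; last first.
  by apply: quad_growthB; [exact: quad_growthZ|exact: quad_growth_cst].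
rewrite integB; [|exact: quad_growthZ|exact: quad_growth_cst].
rewrite integZ // integ_cst.
have := sqr_ge0 (integ i F x - c); lra.
Qed.

End coordinate_integral.

(** * Independence, the Efron-Stein inequality and Doob's inequality *)

Section independence.
Context {d : measure_display} {T : measurableType d} {R : realType}
  {P : probability T R} (xi : nat -> {RV P >-> R}).
Hypothesis xi_iid : iid xi.
Implicit Types (F G : (nat -> R) -> R) (x : nat -> R) (i j k n N : nat).

Let mu := distribution P (xi 0%N).
Hypothesis mu2 : mu.-integrable setT (fun u => (u ^+ 2)%:E).

(** The cylinder events that do not involve xi_i: a pi-system generating the sigma-algebra of the
    other variables. *)
Definition others i : set (set T) := [set A | exists (J : {fset nat}) (B : nat -> set R),
  [/\ i \notin J, forall j, measurable (B j) &
      A = \bigcap_(j in [set` J]) (xi j @^-1` B j)]].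

Lemma measurable_preimage_xi j (B : set R) : measurable B -> measurable (xi j @^-1` B).
Proof. by move=> mB; rewrite -[X in measurable X]setTI; exact: measurable_funP. Qed.

Lemma others_measurable i : others i `<=` measurable.
Proof.
move=> _ [J [B [iJ mB ->]]]; apply: fin_bigcap_measurable => // j _.
exact: measurable_preimage_xi.
Qed.

Lemma others_setT i : others i setT.
Proof.
exists fset0, (fun=> setT); split=> //.
by apply/seteqP; split=> // t _ j /=; rewrite inE.
Qed.

Lemma others_setI i : setI_closed (others i).
Proof.
move=> _ _ [J [B [iJ mB ->]]] [J' [B' [iJ' mB' ->]]].
exists (J `|` J')%fset, (fun j => (if j \in J then B j else setT) `&` (if j \in J' then B' j else setT)).
split.
- by rewrite in_fsetU negb_or iJ.
- by move=> j; apply: measurableI; case: ifP.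
- apply/seteqP; split=> t.
    move=> [h h'] j /= _; split; case: ifPn => //= jJ; [exact: h|exact: h'].
  move=> h; split=> j /= jJ.
    have [] := h j (_ : j \in (J `|` J')%fset); first by rewrite in_fsetU jJ.
    by rewrite jJ.
  have [] := h j (_ : j \in (J `|` J')%fset); first by rewrite in_fsetU jJ orbT.
  by rewrite jJ.
Qed.

Lemma others_indep i A (B : set R) : others i A -> measurable B ->
  P (A `&` xi i @^-1` B) = (P (xi i @^-1` B) * P A)%E.
Proof.
move=> [J [C [iJ mC ->]]] mB.
pose C' j := if j == i then B else C j.
have mC' j : measurable (C' j) by rewrite /C'; case: eqP.
have C'J j : j \in J -> C' j = C j.
  by rewrite /C'; case: eqP => // -> h; rewrite h in iJ.
have -> : \bigcap_(j in [set` J]) (xi j @^-1` C j) `&` xi i @^-1` B =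
    \bigcap_(j in [set` (i |` J)%fset]) (xi j @^-1` C' j).
  apply/seteqP; split=> t.
    move=> [h hi] j /=; rewrite in_fset1U => /orP[/eqP->|jJ]; first by rewrite /C' eqxx.
    by rewrite C'J //; exact: h.
  move=> h; split=> [j /= jJ|].
    by rewrite -C'J //; apply: h; rewrite /= in_fset1U jJ orbT.
  by have := h i; rewrite /C' eqxx /= in_fset1U eqxx; exact.
rewrite xi_iid.1 // big_fsetU1 //= {1}/C' eqxx; congr (_ * _)%E.
rewrite xi_iid.1 // big_seq [RHS]big_seq.
by apply: eq_bigr => j jJ; rewrite C'J.
Qed.

(** Both sides are finite measures in [A] that agree on the pi-system [others i], hence on the
    sigma-algebra it generates. *)
Lemma sigma_others_indep i A (B : set R) : <<s others i >> A -> measurable B ->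
  P (A `&` xi i @^-1` B) = (P A * mu B)%E.
Proof.
move=> sA mB; have mxB := measurable_preimage_xi i mB.
have -> : mu B = P (xi i @^-1` B) by exact: (xi_iid.2 0%N i B mB).
set p := P (xi i @^-1` B); have p_fin : p \is a fin_num by exact: fin_num_measure.
have p0 : 0 <= fine p by exact: fine_ge0 (measure_ge0 P _).
rewrite muleC.
have cov : \bigcup_(k in [set: nat]) [set: T] = setT by apply: bigcup_const; exists 0%N.
have pE C : mscale (NngNum p0) P C = (p * P C)%E by rewrite /mscale /= fineK.
rewrite -pE; apply: (@g_sigma_algebra_measure_unique _ R T (others i) (@others_measurable i)
  (fun=> setT) (fun=> others_setT i) cov (mrestr P mxB) (mscale (NngNum p0) P)
  (@others_setI i) _ _ A sA).
  by move=> C oC; rewrite [RHS]pE; exact: others_indep.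
by move=> k; rewrite [X in (X < _)%E]/(P (setT `&` xi i @^-1` B)) setTI ltey_eq p_fin.
Qed.

Definition Ex F : R := \int[P]_t F (fun j => xi j t).

Definition sigma_others i : measurableType _ := g_sigma_algebraType (others i).

Lemma measurable_id_others i : measurable_fun setT (idfun : T -> sigma_others i).
Proof.
move=> _ A sA; rewrite setTI preimage_id; move: A sA.
by apply: smallest_sub; [exact: sigma_algebra_measurable|exact: others_measurable].
Qed.

Lemma measurable_xi_others i j : j != i ->
  measurable_fun setT (xi j : sigma_others i -> R).
Proof.
move=> ji _ B mB; rewrite setTI; apply: sub_gen_smallest.
exists [fset j]%fset, (fun=> B); split=> //.
  by rewrite in_fset1 eq_sym.
apply/seteqP; split=> t; first by move=> Bt k /=; rewrite in_fset1 => /eqP->.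
by move=> h; apply: h; rewrite /= in_fset1.
Qed.

Lemma measurable_pair_others i :
  measurable_fun setT (fun t : T => (t, xi i t) : sigma_others i * R).
Proof.
apply: measurable_fun_pair; first exact: measurable_id_others.
exact: measurable_funP.
Qed.

Lemma integrable_xi_sqr i : P.-integrable setT (fun t => (xi i t ^+ 2)%:E).
Proof.
have m j : measurable_fun setT (fun t => (xi j t ^+ 2)%:E).
  by apply/measurable_EFinP; apply: measurable_funX; exact: measurable_funP.
have msq : measurable_fun setT (fun u : R => (u ^+ 2)%:E).
  by apply/measurable_EFinP; apply: measurable_funX; exact: measurable_id.
apply/integrableP; split; first exact: m.
case/integrableP: mu2 => _; apply: le_lt_trans.
under eq_integral do rewrite gee0_abs ?lee_fin ?sqr_ge0 //.
under [leRHS]eq_integral do rewrite gee0_abs ?lee_fin ?sqr_ge0 //.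
rewrite -(ge0_integral_distribution (xi i) msq); last by move=> u; rewrite lee_fin sqr_ge0.
rewrite le_eqVlt; apply/orP; left; apply/eqP.
by apply: eq_measure_integral => B mB _; exact: (xi_iid.2 i 0%N B mB).
Qed.

Lemma measurable_functional F : fmeas F -> measurable_fun setT (fun t => F (fun j => xi j t)).
Proof. by move=> mF; apply: (mF _ _ (fun j => xi j)) => j; exact: measurable_funP. Qed.

Lemma integrable_functional F : quad_growth F ->
  P.-integrable setT (EFin \o (fun t => F (fun j => xi j t))).
Proof.
move=> [mF [N [C h]]].
apply: (@le_integrable _ _ _ P setT measurableT _
  (EFin \o (fun t => `|C| * quad N (fun j => xi j t)))) => //.
- by apply/measurable_EFinP; exact: measurable_functional.
- move=> t _ /=; rewrite lee_fin; apply: le_trans (h _) _.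
  apply: le_trans (ler_norm _); rewrite ler_wpM2r ?quad_ge0 //.
  exact: ler_norm.
- rewrite (_ : _ \o _ = (fun t => `|C|%:E * (quad N (fun j => xi j t))%:E)%E) //.
  apply: integrableZl => //; rewrite /quad.
  have -> : (fun t => (1 + \sum_(j < N) xi j t ^+ 2)%:E) =
      (EFin \o cst 1) \+ (fun t => \sum_(j < N) (xi j t ^+ 2)%:E)%E.
    by apply/funext => t /=; rewrite EFinD sumEFin.
  apply: integrableD => //; first exact: finite_measure_integrable_cst.
  by apply: integrable_sum => // j _; exact: integrable_xi_sqr.
Qed.

(** The pair (t, xi_i t) has a product law when t is seen only through the sigma-algebra of the
    other variables, and Fubini's theorem integrates out its second component. Keeping t itself as
    first component avoids a sigma-algebra on sequences. *)
Lemma Ex_integ i F : quad_growth F -> Ex F = Ex (integ mu i F).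
Proof.
move=> qF; have mF := qF.1.
pose X : {mfun T >-> sigma_others i} :=
  HB.pack (idfun : T -> sigma_others i)
    (isMeasurableFun.Build _ _ _ _ (idfun : T -> sigma_others i) (@measurable_id_others i)).
pose phi (t : T) : sigma_others i * R := (t, xi i t).
pose Y : {mfun T >-> (sigma_others i * R)%type} :=
  HB.pack phi (isMeasurableFun.Build _ _ _ _ phi (@measurable_pair_others i)).
pose f (z : sigma_others i * R) := (F (upd (fun j => xi j z.1) i z.2))%:E.
have mf : measurable_fun setT f.
  apply/measurable_EFinP.
  apply: (mF _ _ (fun j (z : sigma_others i * R) => upd (fun j => xi j z.1) i z.2 j)) => j.
  rewrite /upd; case: eqVneq => [_|ji]; first exact: measurable_snd.
  apply: (@measurableT_comp _ _ _ _ _ _ (xi j : sigma_others i -> R)).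
    exact: measurable_xi_others.
  exact: measurable_fst.
have fphi : f \o Y = EFin \o (fun t => F (fun j => xi j t)).
  by apply/funext => t; rewrite /f /=; congr (F _)%:E; exact: upd_same.
have intf : P.-integrable setT (f \o Y) by rewrite fphi; exact: integrable_functional.
have law B : measurable B -> ((distribution P X) \x mu)%E B = distribution P Y B.
  apply: product_measure_unique => A C mA mC.
  exact: sigma_others_indep.
have E1 : (\int[P]_t (F (fun j => xi j t))%:E = \int[(distribution P X) \x mu]_z f z)%E.
  transitivity (\int[P]_t (f \o Y) t)%E; first by rewrite fphi.
  rewrite -(integral_distribution mf intf).
  by apply: eq_measure_integral => B mB _; exact/esym/law.
have intf' : ((distribution P X) \x mu)%E.-integrable setT f.
  apply/integrableP; split=> //.
  rewrite (@eq_measure_integral _ _ _ setT (distribution P Y)); last by move=> B mB _; exact: law.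
  rewrite (ge0_integral_distribution Y) //; last exact: measurableT_comp.
  by case/integrableP: intf.
have FE : fubini_F mu f = fun t => (integ mu i F (fun j => xi j t))%:E.
  apply/funext => t; rewrite /fubini_F /integ /Rintegral fineK //.
  apply: integrable_fin_num => //.
  exact: (integrable_upd mu2 (fun j => xi j t) i qF).
have mF' := measurable_fubini_F intf'.
rewrite /Ex /Rintegral E1 -(integral12_prod_meas1 intf') FE; congr fine.
rewrite FE in mF'.
rewrite (integral_distribution (X := X) mF') //.
exact: integrable_functional (quad_growth_integ mu2 i qF).
Qed.

Lemma Ex_le F G : quad_growth F -> quad_growth G -> (forall x, F x <= G x) -> Ex F <= Ex G.
Proof. by move=> qF qG FG; apply: le_Rintegral => //; exact: integrable_functional. Qed.

Lemma ExD F G : quad_growth F -> quad_growth G ->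
  Ex (fun x => F x + G x) = Ex F + Ex G.
Proof. by move=> qF qG; apply: RintegralD => //; exact: integrable_functional. Qed.

Lemma ExB F G : quad_growth F -> quad_growth G ->
  Ex (fun x => F x - G x) = Ex F - Ex G.
Proof. by move=> qF qG; apply: RintegralB => //; exact: integrable_functional. Qed.

Lemma ExZ c F : quad_growth F -> Ex (fun x => c * F x) = c * Ex F.
Proof. by move=> qF; apply: RintegralZl => //; exact: integrable_functional. Qed.

Lemma Ex_cst c : Ex (fun=> c) = c.
Proof. by rewrite /Ex /Rintegral integral_cst // [X in (_ * X)%E]probability_setT mule1. Qed.

Definition depends_upto k F : Prop :=
  forall x y, (forall j, (1 <= j <= k)%N -> x j = y j) -> F x = F y.

(** Induction on the number of variables. Integrating out the last one gives [G] with the same mean;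
    E F^2 - E G^2 is controlled by the one-variable bound, and the variance of [G] by induction.
    Since [integ] commutes with resetting another coordinate, Jensen's inequality bounds the
    differences of [G] by those of [F]. *)
Theorem efron_stein k F : linear_growth F -> depends_upto k F ->
  Ex (fun x => F x ^+ 2) - Ex F ^+ 2 <=
  \sum_(1 <= i < k.+1) Ex (fun x => (F x - F (upd x i 0)) ^+ 2).
Proof.
elim: k F => [|k IH] F lF dF.
  have -> : F = fun=> F (fun=> 0).
    by apply/funext => x; apply: dF => j; lia.
  by rewrite !Ex_cst big_nil subrr.
pose G := integ mu k.+1 F.
have lG : linear_growth G := linear_growth_integ mu2 k.+1 lF.
have dG : depends_upto k G.
  move=> x y xy; apply: eq_Rintegral => u _; apply: dF => j jk.
  by rewrite /upd; case: eqP => // ?; apply: xy; lia.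
have q2 := linear_sqr lF.
have lD i : linear_growth (fun x => F x - F (upd x i 0)).
  exact: linear_growthB lF (linear_growth_upd i lF).
have lDG i : linear_growth (fun x => G x - G (upd x i 0)).
  exact: linear_growthB lG (linear_growth_upd i lG).
have qD : quad_growth (fun x => (F x - F (upd x k.+1 0)) ^+ 2) := linear_sqr (lD k.+1).
rewrite big_nat_recr //=.
have step : Ex (fun x => F x ^+ 2) - Ex (fun x => G x ^+ 2) <=
    Ex (fun x => (F x - F (upd x k.+1 0)) ^+ 2).
  rewrite (Ex_integ k.+1 q2) (Ex_integ k.+1 qD).
  have qi := quad_growth_integ mu2 k.+1 q2.
  rewrite -(ExB qi (linear_sqr lG)); apply: Ex_le.
  - exact: quad_growthB qi (linear_sqr lG).
  - by have := quad_growth_integ mu2 k.+1 qD.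
  - by move=> x; exact: integ_variance_le.
have {IH} := IH G lG dG.
have -> : Ex G = Ex F by rewrite (Ex_integ k.+1 (linear_quad lF)).
have : \sum_(1 <= i < k.+1) Ex (fun x => (G x - G (upd x i 0)) ^+ 2) <=
    \sum_(1 <= i < k.+1) Ex (fun x => (F x - F (upd x i 0)) ^+ 2).
  rewrite big_nat [leRHS]big_nat; apply: ler_sum => i ik.
  rewrite [leRHS](Ex_integ k.+1 (linear_sqr (lD i))); apply: Ex_le.
  - exact: linear_sqr (lDG i).
  - by have := quad_growth_integ mu2 k.+1 (linear_sqr (lD i)).
  - move=> x; apply: le_trans (sqr_integ_le mu2 k.+1 x (lD i)).
    rewrite integB; [|exact: mu2|exact: linear_quad|exact/linear_quad/linear_growth_upd].
    rewrite le_eqVlt; apply/orP; left; apply/eqP; congr ((_ - _) ^+ 2).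
    by apply: eq_Rintegral => u _; rewrite updC //; lia.
lra.
Qed.

Hypothesis mu1 : \int[mu]_u u = 0.

Let s2 : R := \int[mu]_u (u ^+ 2).

Lemma Ex_mul_coord i H : linear_growth H -> (forall x u, H (upd x i u) = H x) ->
  Ex (fun x => H x * x i) = 0.
Proof.
move=> lH hH; have lc := linear_growth_coord (R := R) i.
rewrite (Ex_integ i (linear_growthM lH lc)).
rewrite (_ : integ _ _ _ = fun=> 0) ?Ex_cst //; apply/funext => x.
rewrite (integMl mu2 _ (linear_quad lc) hH) /integ.
rewrite (_ : \int[mu]_u upd x i u i = \int[mu]_u u); first by rewrite mu1 mulr0.
by apply: eq_Rintegral => u _; rewrite /upd eqxx.
Qed.

Lemma Ex_sqr_coord i : Ex (fun x => x i ^+ 2) = s2.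
Proof.
rewrite (Ex_integ i (linear_sqr (linear_growth_coord i))).
rewrite (_ : integ _ _ _ = fun=> s2) ?Ex_cst //; apply/funext => x.
by apply: eq_Rintegral => u _; rewrite /upd eqxx.
Qed.

(** * Doob's inequality for weighted sums of reordered increments; injectivity of [p] makes each new
    increment independent of the past *)

Section weighted_sums.
Variables (w : nat -> R) (p : nat -> nat) (n : nat).
Hypothesis p_inj : forall j k, (1 <= j <= n)%N -> (1 <= k <= n)%N -> p j = p k -> j = k.

Let S k x := psum (fun j => w j * x (p j)) k.
Let M k x := runmax (psum (fun j => w j * x (p j))) k.

Let lS k : linear_growth (S k).
Proof.
by apply: linear_growth_psum => j; apply: linear_growthZ; exact: linear_growth_coord.
Qed.

Let lM k : linear_growth (M k).
Proof. by apply: (linear_growth_runmax (h := fun k x => S k x)) => j; exact: lS. Qed.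

Let S_upd k l x u : (l <= k < n)%N -> S l (upd x (p k.+1) u) = S l x.
Proof.
move=> lk; apply: eq_psum => j jl; rewrite /upd; case: eqP => // /p_inj h.
by have := h ltac:(lia) ltac:(lia); lia.
Qed.

Let M_upd k x u : (k < n)%N -> M k (upd x (p k.+1) u) = M k x.
Proof.
move=> kn; suff H l : (l <= k)%N -> M l (upd x (p k.+1) u) = M l x by exact: H.
elim: l => [//|l IH] lk; rewrite /M /= -!/(M l _) IH ?(ltnW lk) //.
by congr (Num.max _ _); apply: S_upd; lia.
Qed.

Let ExS k : (k <= n)%N -> Ex (fun x => S k x ^+ 2) = s2 * \sum_(1 <= j < k.+1) w j ^+ 2.
Proof.
elim: k => [|k IH] kn.
  rewrite big_nil mulr0 -[RHS](Ex_cst 0); congr Ex; apply/funext => x.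
  by rewrite /S psum0 expr0n.
have lc := linear_growth_coord (R := R) (p k.+1).
have q1 := linear_sqr (lS k).
have q2 := quad_growthZ (2 * w k.+1) (linear_growthM (lS k) lc).
have q3 := quad_growthZ (w k.+1 ^+ 2) (linear_sqr lc).
rewrite (_ : (fun x => _) = fun x => S k x ^+ 2 + 2 * w k.+1 * (S k x * x (p k.+1))
    + w k.+1 ^+ 2 * x (p k.+1) ^+ 2); last first.
  by apply/funext => x; rewrite /S psumS; ring.
rewrite (ExD (quad_growthD q1 q2) q3) (ExD q1 q2) (ExZ _ (linear_growthM (lS k) lc)).
rewrite (ExZ _ (linear_sqr lc)) Ex_sqr_coord Ex_mul_coord //; last first.
  by move=> x u; apply: (@S_upd k); rewrite leqnn.
rewrite IH ?(ltnW kn) // [in RHS]big_nat_recr //= mulr0 addr0 mulrDr.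
by congr (_ + _); exact: mulrC.
Qed.

Let gap k x := doob_gap (psum (fun j => w j * x (p j))) k.

Let q_gap k : quad_growth (gap k).
Proof.
rewrite (_ : gap k = fun x => 2^-1 * M k x ^+ 2 - M k x * S k x); last first.
  by apply/funext => x; rewrite /gap /doob_gap mulrC.
apply: quad_growthB; first exact/quad_growthZ/linear_sqr.
exact: linear_growthM.
Qed.

(** The gap is a supermartingale started at 0: by [doob_gapS] its increment is at most a function of
    the past times a centred new increment. *)
Let Ex_gap k : (k <= n)%N -> Ex (gap k) <= 0.
Proof.
elim: k => [|k IH] kn.
  rewrite -[leRHS](Ex_cst 0) le_eqVlt; apply/orP; left; apply/eqP; congr Ex.
  by apply/funext => x; rewrite /gap /doob_gap /= psum0 expr0n /= mul0r mulr0 subr0.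
have lc := linear_growth_coord (R := R) (p k.+1).
have q1 := quad_growthZ (w k.+1) (linear_growthM (lM k) lc).
apply: le_trans (IH (ltnW kn)).
apply: (@le_trans _ _ (Ex (fun x => gap k x - w k.+1 * (M k x * x (p k.+1))))).
  apply: Ex_le => //; first exact: quad_growthB.
  move=> x; apply: le_trans (doob_gapS _ _) _.
  by rewrite psumS /gap /M; lra.
rewrite (ExB (q_gap k) q1) (ExZ _ (linear_growthM (lM k) lc)) Ex_mul_coord //.
  by rewrite mulr0 subr0.
by move=> x u; apply: M_upd.
Qed.

Lemma Ex_sqr_runmax : Ex (fun x => M n x ^+ 2) <= 4 * (s2 * \sum_(1 <= j < n.+1) w j ^+ 2).
Proof.
have qs := linear_sqr (lS n).
apply: (@le_trans _ _ (Ex (fun x => 4 * (gap n x + S n x ^+ 2)))).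
  apply: Ex_le; [exact: linear_sqr|exact/quad_growthZ/quad_growthD|].
  by move=> x; exact: runmax_doob.
rewrite (ExZ _ (quad_growthD (q_gap n) qs)) (ExD (q_gap n) qs) ExS //.
by rewrite ler_wpM2l // gerDr Ex_gap.
Qed.

End weighted_sums.

End independence.

(** * The variance of the perimeter *)

Section hull_length_functional.
Context {R : realType}.
Implicit Types (n j k : nat).

Lemma measurable_all (d : measure_display) (W : measurableType d) (I : Type) (r : seq I)
    (b : I -> W -> bool) : (forall i, measurable_fun setT (b i)) ->
  measurable_fun setT (fun w => all (b^~ w) r).
Proof. by move=> mb; elim: r => [|i r IH] /=; [exact: measurable_cst|exact: measurable_and]. Qed.

Lemma measurable_lower_side (d : measure_display) (W : measurableType d)
    (s : nat -> W -> R) n j k : (forall l, measurable_fun setT (s l)) ->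
  measurable_fun setT (fun w => lower_side n (s^~ w) j k).
Proof.
move=> ms; apply: measurable_and; first exact: measurable_cst.
apply: measurable_and; first exact: measurable_cst.
have mgap l : measurable_fun setT (fun w => gap (s^~ w) j k l).
  apply: measurable_funB; first exact: measurable_funB.
  apply: measurable_funM; last exact: measurable_cst.
  by apply: measurable_funM; [exact: measurable_funB|exact: measurable_cst].
rewrite (_ : (fun w => _) = fun w => all (fun l : 'I_n.+1 =>
   (0 <= gap (s^~ w) j k l) && ((gap (s^~ w) j k l == 0) ==> (j <= l <= k)%N))
   (enum 'I_n.+1)).
  apply: (@measurable_all _ _ _ _ (fun (l : 'I_n.+1) w =>
    (0 <= gap (s^~ w) j k l) && ((gap (s^~ w) j k l == 0) ==> (j <= l <= k)%N))) => l.
  apply: measurable_and; first by apply: measurable_fun_ler => //; exact: measurable_cst.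
  under eq_fun do rewrite implybE.
  apply: measurable_or; last exact: measurable_cst.
  by apply: measurable_neg; apply: measurable_fun_eqr => //; exact: measurable_cst.
apply/funext => w; apply/forallP/allP => h l; first by move=> _; exact: h.
by apply: h; rewrite mem_enum.
Qed.

Lemma measurable_sqrtr : measurable_fun setT (@Num.sqrt R).
Proof. by apply: continuous_measurable_fun; exact: sqrt_continuous. Qed.

Lemma sqrt_sum_sqr_le (a b : R) : Num.sqrt (a ^+ 2 + b ^+ 2) <= `|a| + `|b|.
Proof.
rewrite -[leRHS]ger0_norm ?addr_ge0 // -sqrtr_sqr ler_wsqrtr //.
rewrite sqrrD !real_normK ?num_real // lerD2r lerDl.
by rewrite mulrn_wge0 // mulr_ge0.
Qed.

(** The set of sides changes discontinuously with the path, but measurably, and each term is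
    dominated by |k - j| + |S_k - S_j| whether or not it occurs. *)
Lemma linear_growth_lower_length n (h : nat -> (nat -> R) -> R) :
  (forall j, linear_growth (h j)) ->
  linear_growth (fun x => lower_length n (psum (fun j => h j x))).
Proof.
move=> lh; have ls k := linear_growth_psum k lh.
under [X in linear_growth X]eq_fun do rewrite /lower_length big_mkcond /=.
apply: linear_growth_sum => -[j k] _ /=.
have lB := linear_growthB (ls k) (ls j).
have lG := linear_growthD (linear_growth_cst `|k%:R - j%:R|) (linear_growth_norm lB).
apply: linear_growth_dom lG _.
  move=> d W y my.
  have mp l : measurable_fun setT (fun w => psum (fun j => h j (y^~ w)) l).
    exact: ((ls l).1 _ _ y my).
  apply: measurable_fun_ifT; last exact: measurable_cst.
    exact: (measurable_lower_side n j k mp).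
  apply: measurableT_comp; first exact: measurable_sqrtr.
  apply: measurable_funD; first exact: measurable_cst.
  by apply: measurable_funX; exact: measurable_funB.
move=> x; rewrite [leRHS]ger0_norm ?addr_ge0 //; case: ifP => _.
  by rewrite ger0_norm ?sqrtr_ge0 // sqrt_sum_sqr_le.
by rewrite normr0 addr_ge0.
Qed.

Lemma linear_growth_hull_length n : linear_growth (@hull_length R n).
Proof.
apply: linear_growthD; apply: linear_growth_lower_length => j.
  exact: linear_growth_coord.
exact/linear_growthN/linear_growth_coord.
Qed.

Lemma depends_hull_length n : depends_upto n (@hull_length R n).
Proof.
move=> x y xy; have e s s' : (forall j, (j <= n)%N -> s j = s' j) ->
    lower_length n s = lower_length n s' :> R.
  move=> ss; rewrite /lower_length.
  have le (j : 'I_n.+1) : (j <= n)%N by rewrite -ltnS.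
  apply: eq_big => [[j k]|[j k] _] /=; last by rewrite !ss.
  rewrite /lower_side; do 2 congr (_ && _).
  by apply: eq_forallb => l; rewrite /gap /chord !ss.
rewrite /hull_length; congr (_ + _); apply: e => j jn; apply: eq_psum => l ?.
  by rewrite xy //; lia.
by rewrite xy //; lia.
Qed.

End hull_length_functional.

(** * The contribution of large increments *)

Section truncated_third_moment.
Context {R : realType}.
Implicit Types (n r : nat) (u : R).

Definition jump_term (r : nat) (u : R) : R := u ^+ 4 / (`|u| + r%:R) ^+ 2.

(** The last factor is a smooth stand-in for the minimum of |u| and n: it lies between half of it
    and all of it. *)
Definition truncated_third (n : nat) (u : R) : R := u ^+ 2 * (`|u| * n%:R / (`|u| + n%:R)).

Lemma measurable_invr_ge0 (d' : measure_display) (W : measurableType d') (f : W -> R) :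
  measurable_fun setT f -> (forall w, 0 <= f w) -> measurable_fun setT (fun w => (f w)^-1).
Proof.
move=> mf f0; under eq_fun do rewrite -powR_inv1 //.
by apply: (measurableT_comp (measurable_powR (R := R) (-1))).
Qed.

Lemma measurable_jump_term r : measurable_fun setT (jump_term r).
Proof.
apply: measurable_funM; first by apply: measurable_funX; exact: measurable_id.
apply: measurable_invr_ge0 => [|u]; last exact: sqr_ge0.
apply: measurable_funX; apply: measurable_funD; last exact: measurable_cst.
exact: normr_measurable.
Qed.

Lemma measurable_truncated_third n : measurable_fun setT (truncated_third n).
Proof.
apply: measurable_funM; first by apply: measurable_funX; exact: measurable_id.
apply: measurable_funM.
  by apply: measurable_funM; [exact: normr_measurable|exact: measurable_cst].
apply: measurable_invr_ge0 => [|u]; last by rewrite addr_ge0.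
by apply: measurable_funD; [exact: normr_measurable|exact: measurable_cst].
Qed.

Lemma jump_term_ge0 r u : 0 <= jump_term r u.
Proof. by rewrite divr_ge0 ?sqr_ge0 // (exprM u 2 2) sqr_ge0. Qed.

Lemma truncated_third_ge0 n u : 0 <= truncated_third n u.
Proof. by rewrite mulr_ge0 ?sqr_ge0 // divr_ge0 ?mulr_ge0 ?addr_ge0. Qed.

Lemma jump_term_le r u : jump_term r u <= u ^+ 2.
Proof.
have [->|u0] := eqVneq u 0; first by rewrite /jump_term !expr0n mul0r.
have a0 : 0 < `|u| by rewrite normr_gt0.
have r0 : 0 <= r%:R :> R by rewrite ler0n.
rewrite /jump_term ler_pdivrMr ?exprn_gt0 //; last lra.
rewrite (exprD u 2 2) ler_wpM2l ?sqr_ge0 // -(real_normK (num_real u)).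
by rewrite lerXn2r ?nnegrE //; lra.
Qed.

Lemma truncated_third_le n u : truncated_third n u <= n%:R * u ^+ 2.
Proof.
rewrite /truncated_third mulrC ler_wpM2r ?sqr_ge0 //.
have [->|n0] := posnP n; first by rewrite mulr0 mul0r.
have n0' : 0 < n%:R :> R by rewrite ltr0n.
have a0 : 0 <= `|u| by [].
rewrite ler_pdivrMr; nra.
Qed.

Lemma sum_jump_term n u :
  \sum_(1 <= i < n.+1) jump_term i u <= truncated_third n u.
Proof.
rewrite /truncated_third; apply: le_trans (ler_wpM2l (sqr_ge0 u) (sum_sqr_ratio n (normr_ge0 u))).
rewrite mulr_sumr; apply: ler_sum => i _.
by rewrite real_normK ?num_real // mulrA -exprD.
Qed.

Variable mu : probability R R.
Hypothesis mu2 : mu.-integrable setT (fun u => (u ^+ 2)%:E).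

Lemma integrable_le_sqr (f : R -> R) (c : R) : measurable_fun setT f ->
  (forall u, 0 <= f u) -> (forall u, f u <= c * u ^+ 2) -> mu.-integrable setT (EFin \o f).
Proof.
move=> mf f0 fc.
apply: (@le_integrable _ _ _ mu setT measurableT _ (EFin \o (fun u => c * u ^+ 2))) => //.
- exact/measurable_EFinP.
- by move=> u _ /=; rewrite lee_fin ger0_norm // (le_trans (fc u)) // ler_norm.
- rewrite (_ : _ \o _ = (fun u => c%:E * (u ^+ 2)%:E)%E) //.
  exact: integrableZl.
Qed.

Lemma integrable_jump_term r : mu.-integrable setT (EFin \o jump_term r).
Proof.
apply: (@integrable_le_sqr _ 1) => [|u|u]; first exact: measurable_jump_term.
  exact: jump_term_ge0.
by rewrite mul1r jump_term_le.
Qed.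

Lemma integrable_truncated_third n : mu.-integrable setT (EFin \o truncated_third n).
Proof.
apply: (@integrable_le_sqr _ n%:R) => [|u|u]; first exact: measurable_truncated_third.
  exact: truncated_third_ge0.
exact: truncated_third_le.
Qed.

Lemma sum_Rintegral_jump_term n :
  \sum_(1 <= i < n.+1) \int[mu]_u jump_term i u <= \int[mu]_u truncated_third n u.
Proof.
have main k : \sum_(1 <= i < k.+1) \int[mu]_u jump_term i u = \int[mu]_u (\sum_(1 <= i < k.+1) jump_term i u) /\
    mu.-integrable setT (EFin \o (fun u => \sum_(1 <= i < k.+1) jump_term i u)).
  elim: k => [|k [IH1 IH2]].
    rewrite big_nil (_ : (fun u => _) = cst 0); last by apply/funext => u; rewrite big_nil.
    split; last exact: finite_measure_integrable_cst.
    exact: esym (Rintegral_cst_prob mu 0).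
  have e : (fun u => \sum_(1 <= i < k.+2) jump_term i u) =
      fun u => \sum_(1 <= i < k.+1) jump_term i u + jump_term k.+1 u.
    by apply/funext => u; rewrite big_nat_recr.
  rewrite e big_nat_recr //= IH1; split.
    by rewrite [RHS]RintegralD //; exact: integrable_jump_term.
  exact: (integrableD measurableT IH2 (integrable_jump_term k.+1)).
have [-> i1] := main n; apply: le_Rintegral => //.
  exact: integrable_truncated_third.
by move=> u _; exact: sum_jump_term.
Qed.

End truncated_third_moment.

Section variance_bound.
Context {d : measure_display} {T : measurableType d} {R : realType}
  {P : probability T R} (xi : nat -> {RV P >-> R}).
Hypothesis xi_iid : iid xi.
Implicit Types (F G : (nat -> R) -> R) (x : nat -> R) (i j k n : nat).

Let mu := distribution P (xi 0%N).
Hypothesis mu2 : mu.-integrable setT (fun u => (u ^+ 2)%:E).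
Hypothesis mu1 : \int[mu]_u u = 0.

Let s2 : R := \int[mu]_u (u ^+ 2).

Let s2_ge0 : 0 <= s2.
Proof. by apply: Rintegral_ge0 => u _; exact: sqr_ge0. Qed.

(** The constant is 4 from Doob's inequality, times 2 from the squared weights, times 2 + 2 from
    splitting the two one-sided maxima. *)
Lemma Ex_sqr_outer_maxsum n i : (0 < i <= n)%N ->
  Ex xi (fun x => outer_maxsum n i (upd x i 0) ^+ 2) <= 32 * s2 / (dist_to_end n i)%:R.
Proof.
move=> i1n; set r := dist_to_end n i.
have r0 : (0 < r)%N by rewrite /r /dist_to_end; lia.
(* Erasing the i-th increment is transferred from the sequence to the weights, so that the maximal
   inequality applies to the original increments. *)
pose w j : R := if rho n i j == i then 0 else weight r j.
have rho_inj j k : (1 <= j <= n)%N -> (1 <= k <= n)%N -> rho n i j = rho n i k -> j = k.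
  by rewrite /rho; case: ifP => _; lia.
have wle : \sum_(1 <= j < n.+1) w j ^+ 2 <= 2 / r%:R.
  apply: le_trans (sum_sqr_weight n r0); apply: ler_sum => j _.
  by rewrite /w; case: ifP => // _; rewrite expr0n /= sqr_ge0.
have E (c : R) x j : c * weight r j * upd x i 0 (rho n i j) = c * w j * x (rho n i j).
  by rewrite /upd /w; case: ifP => _; rewrite ?mulr0 ?mul0r.
pose M (c : R) x := runmax (psum (fun j => c * w j * x (rho n i j))) n.
have lM c : linear_growth (M c).
  apply: (linear_growth_runmax (h := fun k x => psum (fun j => c * w j * x (rho n i j)) k)) => k.
  by apply: linear_growth_psum => j; apply: linear_growthZ; exact: linear_growth_coord.
have EM (c : R) : c ^+ 2 = 1 -> Ex xi (fun x => M c x ^+ 2) <= 8 * s2 / r%:R.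
  move=> c1; apply: le_trans (Ex_sqr_runmax xi_iid mu2 mu1 _ rho_inj) _.
  under eq_bigr do rewrite exprMn c1 mul1r.
  rewrite (_ : 8 * s2 / r%:R = 4 * (s2 * (2 / r%:R))); last by ring.
  by rewrite ler_wpM2l // ler_wpM2l.
have bound x : outer_maxsum n i (upd x i 0) ^+ 2 <= 2 * M 1 x ^+ 2 + 2 * M (-1) x ^+ 2.
  apply: le_trans (sqr_maxsum _ _ _) _; rewrite le_eqVlt; apply/orP; left; apply/eqP.
  rewrite /M; congr (2 * _ ^+ 2 + 2 * _ ^+ 2); congr (runmax (psum _) n); apply/funext => j.
    by rewrite -E mul1r.
  by rewrite -E mulN1r.
have qM c := quad_growthZ 2 (linear_sqr (lM c)).
have qZ : quad_growth (fun x => outer_maxsum n i (upd x i 0) ^+ 2).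
  apply: linear_sqr; apply: (@linear_growth_upd R (outer_maxsum n i) i).
  by apply: linear_growthD;
    apply: (linear_growth_runmax (h := fun k x => psum (fun j => _ * x (rho n i j)) k)) => k;
    apply: linear_growth_psum => j; apply: linear_growthZ; exact: linear_growth_coord.
apply: le_trans (Ex_le xi_iid mu2 qZ (quad_growthD (qM 1) (qM (-1))) bound) _.
rewrite (ExD xi_iid mu2 (qM 1) (qM (-1))) !(ExZ xi_iid mu2 _ (linear_sqr (lM _))).
have := EM 1 (expr1n _ _); have := EM (-1) (etrans (sqrrN 1) (expr1n _ _)).
lra.
Qed.

Let m r : R := \int[mu]_u jump_term r u.

Lemma Ex_sqr_hull_length_upd n i : (0 < i <= n)%N ->
  Ex xi (fun x => (hull_length n x - hull_length n (upd x i 0)) ^+ 2) <=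
  288 * s2 * (32 * s2 / (dist_to_end n i)%:R) + 32 * m (dist_to_end n i).
Proof.
move=> i1n; set r := dist_to_end n i.
have lL := @linear_growth_hull_length R n.
have lD : linear_growth (fun x => hull_length n x - hull_length n (upd x i 0)).
  exact: linear_growthB lL (linear_growth_upd i lL).
have qD : quad_growth (fun x => (hull_length n x - hull_length n (upd x i 0)) ^+ 2).
  exact: linear_sqr lD.
pose Z x := outer_maxsum n i (upd x i 0).
have qZ : quad_growth (fun x => Z x ^+ 2).
  apply: linear_sqr; apply: (@linear_growth_upd R (outer_maxsum n i) i).
  by apply: linear_growthD;
    apply: (linear_growth_runmax (h := fun k x => psum (fun j => _ * x (rho n i j)) k)) => k;
    apply: linear_growth_psum => j; apply: linear_growthZ; exact: linear_growth_coord.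
have qB : quad_growth (fun x => 288 * s2 * Z x ^+ 2 + 32 * m r).
  by apply: quad_growthD; [exact: quad_growthZ|exact: quad_growth_cst].
(* The pathwise bound contains x_i^2 Z^2, which is of quartic growth and cannot be compared under
   [Ex]. With the other coordinates fixed, Z is a constant and the bound is integrable in the i-th
   one. *)
rewrite (Ex_integ xi_iid mu2 i qD).
apply: (@le_trans _ _ (Ex xi (fun x => 288 * s2 * Z x ^+ 2 + 32 * m r))).
  apply: (Ex_le xi_iid mu2) => //; first by have := quad_growth_integ mu2 i qD.
  move=> x; have i1 : mu.-integrable setT (EFin \o (fun u => 288 * Z x ^+ 2 * u ^+ 2)).
    by rewrite (_ : _ \o _ = (fun u => (288 * Z x ^+ 2)%:E * (u ^+ 2)%:E)%E) //; exact: integrableZl.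
  have i2 : mu.-integrable setT (EFin \o (fun u => 32 * jump_term r u)).
    rewrite (_ : _ \o _ = (fun u => 32%:E * (jump_term r u)%:E)%E) //.
    by apply: integrableZl => //; exact: integrable_jump_term mu2 _.
  apply: (@le_trans _ _ (\int[mu]_u (288 * Z x ^+ 2 * u ^+ 2 + 32 * jump_term r u))).
    apply: le_Rintegral => //; first exact: (integrable_upd mu2 x i qD).
      exact: (integrableD measurableT i1 i2).
    move=> u _; apply: le_trans (sqr_hull_length_upd _ i1n) _.
    rewrite updK /upd eqxx -/(upd x i 0) -/(Z x) /jump_term -/r.
    by rewrite le_eqVlt; apply/orP; left; apply/eqP; ring.
  rewrite RintegralD // RintegralZl // RintegralZl //; last exact: integrable_jump_term mu2 _.
  by rewrite -/s2 -/(m r) le_eqVlt; apply/orP; left; apply/eqP; ring.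
rewrite (ExD xi_iid mu2 (quad_growthZ _ qZ) (quad_growth_cst _)) Ex_cst (ExZ xi_iid mu2 _ qZ).
rewrite lerD2r; apply: ler_wpM2l; last exact: Ex_sqr_outer_maxsum.
exact: mulr_ge0 (ler0n _ _) s2_ge0.
Qed.

Theorem hull_length_variance n :
  Ex xi (fun x => hull_length n x ^+ 2) - Ex xi (hull_length n) ^+ 2 <=
  2 * (288 * s2 * (32 * s2)) * \sum_(1 <= i < n.+1) i%:R^-1 + 64 * \int[mu]_u truncated_third n u.
Proof.
apply: le_trans (efron_stein xi_iid mu2 (@linear_growth_hull_length R n) (@depends_hull_length R n)) _.
apply: (@le_trans _ _ (\sum_(1 <= i < n.+1)
    (288 * s2 * (32 * s2 / (dist_to_end n i)%:R) + 32 * m (dist_to_end n i)))).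
  rewrite big_nat [leRHS]big_nat; apply: ler_sum => i i1n.
  by apply: Ex_sqr_hull_length_upd; lia.
rewrite big_split /= -!mulr_sumr; apply: lerD.
  have : 0 <= 288 * s2 * (32 * s2).
    exact: mulr_ge0 (mulr_ge0 (ler0n _ _) s2_ge0) (mulr_ge0 (ler0n _ _) s2_ge0).
  have := sum_dist_to_end (f := fun i => i%:R^-1 : R) n (fun i => ltac:(by rewrite invr_ge0 ler0n)).
  set S := \sum_(1 <= i < n.+1) (dist_to_end n i)%:R^-1.
  set S' := \sum_(1 <= i < n.+1) i%:R^-1 => h.
  rewrite (mulrA (288 * s2) (32 * s2) S); move: (288 * s2 * (32 * s2)) => c c0.
  by rewrite (mulrC 2 c) -mulrA ler_wpM2l.
rewrite (_ : 64 * _ = 32 * (2 * \int[mu]_u truncated_third n u)); last by ring.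
rewrite ler_wpM2l //; apply: le_trans (sum_dist_to_end _ _) _.
  by move=> i; apply: Rintegral_ge0 => u _; exact: jump_term_ge0.
by rewrite ler_wpM2l // (sum_Rintegral_jump_term mu2).
Qed.

Lemma hull_perimeterE n : hull_perimeter xi n = fun t => hull_length n (fun j => xi j t).
Proof.
apply/funext => t; rewrite /hull_perimeter (_ : walk_points xi n t =
  graph_points (psum (fun j => xi j t)) n) // perimeter_hull.
by rewrite /hull_length; congr (_ + lower_length _ _); apply/funext => l; rewrite psumN.
Qed.

Lemma variance_hull_perimeter n : ('V_P[hull_perimeter xi n] < +oo)%E /\
  fine 'V_P[hull_perimeter xi n]%E =
  Ex xi (fun x => hull_length n x ^+ 2) - Ex xi (hull_length n) ^+ 2.
Proof.
have lL := @linear_growth_hull_length R n.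
have q1 := linear_quad lL; have q2 := linear_sqr lL.
set c := Ex xi (hull_length n).
have qv : quad_growth (fun x => (hull_length n x - c) ^+ 2).
  by apply: linear_sqr; apply: linear_growthB => //; exact: linear_growth_cst.
have VE : ('V_P[hull_perimeter xi n] =
    \int[P]_t ((hull_length n (fun j => xi j t) - c) ^+ 2)%:E)%E.
  rewrite /variance unlock /= !unlock hull_perimeterE; apply: eq_integral => t _ /=.
  by rewrite -expr2.
have iv := integrable_functional xi_iid mu2 qv.
have fv := integrable_fin_num measurableT iv.
rewrite VE; split; first by move: fv; rewrite fin_numElt => /andP[].
rewrite -[LHS]/(Ex xi (fun x => (hull_length n x - c) ^+ 2)).
rewrite (_ : (fun x => _) = fun x => hull_length n x ^+ 2 - (2 * c * hull_length n x - c ^+ 2)); last first.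
  by apply/funext => x; ring.
have qc := quad_growthZ (2 * c) q1.
rewrite (ExB xi_iid mu2 q2 (quad_growthB qc (quad_growth_cst _))).
by rewrite (ExB xi_iid mu2 qc (quad_growth_cst _)) (ExZ xi_iid mu2 _ q1) Ex_cst -/c; ring.
Qed.

End variance_bound.

(** * Asymptotics *)

Section asymptotics.
Context {R : realType}.

Lemma harmonic_sum_le n : (0 < n)%N -> \sum_(1 <= i < n.+1) i%:R^-1 <= 1 + ln n%:R :> R.
Proof.
elim: n => // n IH _; have [->|n0] := posnP n.
  by rewrite big_nat1 invr1 ln1 addr0.
rewrite big_nat_recr //=; apply: le_trans (lerD (IH n0) (lexx _)) _.
have n0' : 0 < n%:R :> R by rewrite ltr0n.
have n1' : 0 < n.+1%:R :> R by rewrite ltr0n.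
(* The inequality ln (1 + x) <= x at x = -1/(n + 1) gives 1/(n + 1) <= ln (n + 1) - ln n. *)
have h : -1 < - n.+1%:R^-1 :> R by rewrite ltrN2 invf_lt1 // ltr1n ltnS.
have := le_ln1Dx h.
have -> : 1 - n.+1%:R^-1 = n%:R / n.+1%:R :> R.
  by rewrite -[n.+1%:R]natr1; field; rewrite gt_eqF //; lra.
rewrite ln_div ?posrE //.
move: (ln n.+1%:R) (ln n%:R) (n.+1%:R^-1) => A B D ?; lra.
Qed.

Lemma near_powRN_le (b e : R) : 0 < b -> 0 < e ->
  \forall n \near \oo, n%:R `^ (- b) <= e.
Proof.
move=> b0 e0; near=> n.
have n0 : 0 < n%:R :> R by rewrite ltr0n; near: n; exact: nbhs_infty_gt.
rewrite powRN -[leRHS]invrK lef_pV2 ?posrE ?invr_gt0 ?powR_gt0 //.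
have -> : e^-1 = (e^-1 `^ b^-1) `^ b.
  by rewrite -powRrM mulVf ?gt_eqF // powRr1 // invr_ge0 ltW.
rewrite ge0_ler_powR ?nnegrE ?powR_ge0 ?(ltW b0) ?(ltW n0) //.
by near: n; exact: nbhs_infty_ger.
Unshelve. all: by end_near. Qed.

Lemma ln_le_powR (a x : R) : 0 < a -> 0 < x -> ln x <= a^-1 * x `^ a.
Proof.
move=> a0 x0; rewrite mulrC ler_pdivlMr // mulrC -ln_powR.
by apply/ltW/ln_sublinear; exact: powR_gt0.
Qed.

(** The exponents p - 2 and 3 - p are nonnegative with sum 1, so n^(p-2) a^(3-p) <= a + n for a =
    |u|. The bound is uniform in n, as dominated convergence requires. *)
Lemma truncated_third_dom (p u : R) n : 2 <= p -> p <= 3 -> (0 < n)%N ->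
  n%:R `^ (p - 3) * truncated_third n u <= `|u| `^ p.
Proof.
move=> p2 p3 n0; have n0' : 0 < n%:R :> R by rewrite ltr0n.
have [->|u0] := eqVneq u 0.
  by rewrite /truncated_third expr0n mul0r mulr0 powR_ge0.
have a0 : 0 < `|u| by rewrite normr_gt0.
rewrite /truncated_third -(real_normK (num_real u)).
set a := `|u| in a0 *; set N := n%:R in n0' *.
have aN : 0 < a + N by rewrite addr_gt0.
have e1 : N `^ (p - 3) * N = N `^ (p - 2).
  rewrite -[X in _ * X]powRr1 ?(ltW n0') // -powRD ?(lt0r_neq0 n0') ?implybT //.
  by congr (_ `^ _); lra.
have e2 : a ^+ 2 * a = a `^ p * a `^ (3 - p).
  have -> : a ^+ 2 * a = a `^ 3%:R by rewrite powR_mulrn ?(ltW a0) //; exact: esym (exprSr a 2).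
  by rewrite -powRD ?(lt0r_neq0 a0) ?implybT //; congr (_ `^ _); lra.
have key : N `^ (p - 2) * a `^ (3 - p) <= a + N.
  rewrite -[leRHS]powRr1 ?(ltW aN) //.
  have -> : (a + N) `^ 1 = (a + N) `^ (p - 2) * (a + N) `^ (3 - p).
    by rewrite -powRD ?(lt0r_neq0 aN) ?implybT //; congr (_ `^ _); lra.
  apply: ler_pM; rewrite ?powR_ge0 //; apply: ge0_ler_powR; rewrite ?nnegrE; lra.
have -> : N `^ (p - 3) * (a ^+ 2 * (a * N / (a + N))) =
    a `^ p * (N `^ (p - 2) * a `^ (3 - p) / (a + N)).
  move: (a + N)^-1 => v; rewrite -e1.
  have -> : N `^ (p - 3) * (a ^+ 2 * (a * N * v)) = N `^ (p - 3) * N * (a ^+ 2 * a) * v by ring.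
  by rewrite e2; ring.
rewrite ler_piMr ?powR_ge0 // ler_pdivrMr // mul1r; exact: key.
Qed.

Lemma truncated_third_le_cube (u : R) n : truncated_third n u <= `|u| ^+ 3.
Proof.
rewrite /truncated_third -(real_normK (num_real u)) (exprSr _ 2) ler_wpM2l ?sqr_ge0 //.
have [->|u0] := eqVneq u 0; first by rewrite normr0 !mul0r.
have a0 : 0 < `|u| by rewrite normr_gt0.
have n0 : 0 <= n%:R :> R by rewrite ler0n.
rewrite ler_pdivrMr; nra.
Qed.

Lemma powR_lower_exponent (a : R) (k : nat) p : 0 <= a -> k%:R <= p -> a ^+ k <= 1 + a `^ p.
Proof.
move=> a0 kp; have [a1|a1] := leP 1 a.
  rewrite -powR_mulrn // (le_trans (ler_powR a1 kp)) // lerDr //.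
by rewrite (le_trans (exprn_ile1 _ a0 (ltW a1))) // lerDl powR_ge0.
Qed.

End asymptotics.

Section moments.
Context {R : realType} (mu : probability R R) (p : R).
Hypothesis mup : mu.-integrable setT (fun u => (`|u| `^ p)%:E).

Lemma integrable_power (k : nat) : k%:R <= p -> mu.-integrable setT (fun u => (`|u| ^+ k)%:E).
Proof.
move=> kp.
apply: (@le_integrable _ _ _ mu setT measurableT _ (EFin \o (fun u => 1 + `|u| `^ p))) => //.
- by apply/measurable_EFinP; apply: measurable_funX; exact: normr_measurable.
- move=> u _ /=; rewrite lee_fin (ger0_norm (exprn_ge0 k (normr_ge0 u))).
  exact: le_trans (powR_lower_exponent (normr_ge0 u) kp) (ler_norm _).
- exact: (integrableD measurableT (finite_measure_integrable_cst mu 1 measurableT) mup).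
Qed.

Lemma integrable_square : 2 <= p -> mu.-integrable setT (fun u => (u ^+ 2)%:E).
Proof.
move=> p2; rewrite (_ : (fun u => _) = fun u => (`|u| ^+ 2)%:E).
  exact: integrable_power.
by apply/funext => u; rewrite real_normK ?num_real.
Qed.

Lemma Rintegral_truncated_third_bounded : 3 <= p ->
  exists K, forall n, \int[mu]_u truncated_third n u <= K.
Proof.
move=> p3; exists (\int[mu]_u (`|u| ^+ 3)) => n; apply: le_Rintegral => //.
- by apply: integrable_truncated_third; apply: integrable_square; lra.
- exact: integrable_power.
- by move=> u _; exact: truncated_third_le_cube.
Qed.

(** For fixed u the integrand is at most n^(p-3) |u|^3, which tends to 0 as p < 3; the integrable
    dominating function is |u|^p. *)
Lemma Rintegral_truncated_third_cvg : 2 <= p -> p < 3 ->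
  (fun n => n%:R `^ (p - 3) * \int[mu]_u truncated_third n u) @ \oo --> (0 : R).
Proof.
move=> p2 p3.
have it n : mu.-integrable setT (EFin \o truncated_third n).
  by apply: integrable_truncated_third; exact: integrable_square.
(* The index is shifted because the domination is available only for n > 0. *)
pose f_ n (u : R) := (n.+1%:R `^ (p - 3) * truncated_third n.+1 u)%:E.
have mf n : measurable_fun setT (f_ n).
  apply/measurable_EFinP; apply: measurable_funM; first exact: measurable_cst.
  exact: measurable_truncated_third.
have f0 u n : 0 <= n.+1%:R `^ (p - 3) * truncated_third n.+1 u.
  by rewrite mulr_ge0 ?powR_ge0 ?truncated_third_ge0.
have cvgf : {ae mu, forall u, [set: R] u -> f_ ^~ u @ \oo --> (0 : \bar R)%E}.
  apply: aeW => u _; apply: cvg_EFin; first exact: nearW.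
  apply/cvgrPdist_le => e e0; have b0 : 0 < 3 - p by lra.
  have c0 : 0 < 1 + `|u| ^+ 3 by rewrite ltr_pwDl // exprn_ge0.
  have [N _ hN] := near_powRN_le b0 (divr_gt0 e0 c0).
  exists N => // n Nn /=; rewrite sub0r normrN ger0_norm //.
  apply: le_trans (ler_wpM2l (powR_ge0 _ _) (truncated_third_le_cube u n.+1)) _.
  apply: (@le_trans _ _ (n.+1%:R `^ (p - 3) * (1 + `|u| ^+ 3))).
    by rewrite ler_wpM2l ?powR_ge0 // lerDr.
  by rewrite -ler_pdivlMr // -opprB; apply: hN; exact: leq_trans Nn (leqnSn n).
have domf : {ae mu, forall u n, [set: R] u -> (`|f_ n u| <= (`|u| `^ p)%:E)%E}.
  apply: aeW => u n _; rewrite /f_ abse_EFin lee_fin ger0_norm //.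
  by apply: truncated_third_dom => //; exact: ltW.
have [_ _] := @dominated_convergence _ _ _ mu setT measurableT f_ (cst 0%E)
  (fun u => (`|u| `^ p)%:E) mf (measurable_cst _) cvgf mup domf.
rewrite integral0 => h.
rewrite -cvg_shiftS /=.
have -> : (fun n => n.+1%:R `^ (p - 3) * \int[mu]_u truncated_third n.+1 u) =
    fine \o (fun n => \int[mu]_u f_ n u)%E.
  apply/funext => n /=; rewrite -RintegralZl //.
exact: (fine_cvg h).
Qed.

End moments.

(** Finiteness is asserted separately because [fine] sends an infinite variance to 0, for which the
    asymptotic claims would be void. *)
Theorem corollary1p6 (d : measure_display) (T : measurableType d)
    (R : realType) (P : probability T R) (xi : nat -> {RV P >-> R}) (p : R)
    (xi_iid : iid xi)
    (xi_mean : ('E_P[xi 0%N] = 0)%E)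
    (xi_moment : ('E_P[fun t => (`|xi 0%N t| `^ p)%R] < +oo)%E) :
  [/\ 2 <= p -> forall n : nat, ('V_P[hull_perimeter xi n] < +oo)%E,
      2 <= p < 3 ->
        (fun n : nat => fine ('V_P[hull_perimeter xi n])%E) =o_\oo
        (fun n : nat => n%:R `^ (3 - p)) &
      3 <= p ->
        (fun n : nat => fine ('V_P[hull_perimeter xi n])%E) =O_\oo
        (fun n : nat => ln n%:R)].
Proof.
pose mu := distribution P (xi 0%N).
have mpow : measurable_fun setT (fun u : R => (`|u| `^ p)%:E).
  apply/measurable_EFinP; apply: (measurableT_comp (measurable_powR (R := R) p)).
  exact: normr_measurable.
have mup : mu.-integrable setT (fun u => (`|u| `^ p)%:E).
  apply/integrableP; split=> //.
  under eq_integral do rewrite gee0_abs ?lee_fin ?powR_ge0 //.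
  rewrite (ge0_integral_distribution (xi 0%N) mpow); last by move=> u; rewrite lee_fin powR_ge0.
  by move: xi_moment; rewrite unlock.
have mu2 : 2 <= p -> mu.-integrable setT (fun u => (u ^+ 2)%:E).
  by move=> p2; exact: integrable_square mup p2.
have mu1 : 2 <= p -> \int[mu]_u u = 0.
  move=> p2; have i1 : mu.-integrable setT (EFin \o (fun u : R => u)).
    apply: (@le_integrable _ _ _ mu setT measurableT _ (fun u => (`|u| ^+ 1)%:E)).
    - by apply/measurable_EFinP; exact: measurable_id.
    - by move=> u _ /=; rewrite lee_fin expr1 normr_id.
    - by apply: (integrable_power mup); lra.
  have iP : P.-integrable setT ((EFin \o (fun u : R => u)) \o xi 0%N).
    have := linear_quad (linear_growth_coord (R := R) 0).
    by move=> /(integrable_functional xi_iid (mu2 p2)).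
  rewrite /Rintegral (integral_distribution (X := xi 0%N) _ iP); last first.
    by apply/measurable_EFinP; exact: measurable_id.
  by move: xi_mean; rewrite unlock => ->.
set s2 := \int[mu]_u (u ^+ 2).
set C := 2 * (288 * s2 * (32 * s2)).
pose J n := \int[mu]_u truncated_third n u.
have s2_ge0 : 0 <= s2 by apply: Rintegral_ge0 => u _; exact: sqr_ge0.
have C0 : 0 <= C.
  exact: mulr_ge0 (ler0n _ _) (mulr_ge0 (mulr_ge0 (ler0n _ _) s2_ge0) (mulr_ge0 (ler0n _ _) s2_ge0)).
have J0 n : 0 <= J n by apply: Rintegral_ge0 => u _; exact: truncated_third_ge0.
have V n : 2 <= p -> (0 < n)%N ->
    `|fine ('V_P[hull_perimeter xi n])%E| <= C * (1 + ln n%:R) + 64 * J n.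
  move=> p2 n0; rewrite ger0_norm ?fine_ge0 ?variance_ge0 //.
  have [_ ->] := variance_hull_perimeter xi_iid (mu2 p2) n.
  apply: le_trans (hull_length_variance xi_iid (mu2 p2) (mu1 p2) n) _.
  by rewrite -/s2 -/C -/(J n) lerD2r; apply: ler_wpM2l => //; exact: harmonic_sum_le.
clearbody C; split.
- by move=> p2 n; have [] := variance_hull_perimeter xi_iid (mu2 p2) n.
- move=> /andP[p2 p3]; apply/eqoP => e e0.
  pose b := 3 - p; have b0 : 0 < b by rewrite /b; lra.
  have Jc := Rintegral_truncated_third_cvg mup p2 p3.
  (* Half of e is reserved for the term in C, with C + 1 guarding against C = 0, and half for 64 J
     n, hence the e / 128 below. *)
  pose e1 := e / (2 * (C + 1)).
  have e10 : 0 < e1 by rewrite divr_gt0 //; lra.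
  have e1E : 2 * (C + 1) * e1 = e by rewrite /e1 mulrC divfK // gt_eqF //; lra.
  (* The logarithm is absorbed by ln n <= (2/b) n^(b/2), so ln n * n^(-b) is at most (2/b)
     n^(-b/2). *)
  have c0 : 0 < e1 / 2 / (2 / b) by apply: divr_gt0; apply: divr_gt0.
  have h3 := near_powRN_le (divr_gt0 b0 (ltr0Sn _ 1)) c0.
  have h2 := near_powRN_le b0 (divr_gt0 e10 (ltr0Sn _ 1)).
  have e20 : 0 < e / 128 by rewrite divr_gt0.
  move/cvgrPdist_le: Jc => /(_ _ e20) h1.
  near=> n.
  have n0 : (0 < n)%N by near: n; exact: nbhs_infty_gt.
  have n0' : 0 < n%:R :> R by rewrite ltr0n.
  apply: le_trans (V n p2 n0) _.
  rewrite ger0_norm ?powR_ge0 // -/b.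
  have Nb : 0 < n%:R `^ b by exact: powR_gt0.
  rewrite -ler_pdivrMr // -powRN mulrDl.
  have H1 : J n * n%:R `^ (- b) <= e / 128.
    have : `|0 - n%:R `^ (p - 3) * J n| <= e / 128 by near: n.
    by rewrite sub0r normrN ger0_norm ?mulr_ge0 ?powR_ge0 // mulrC /b opprB.
  have H2 : n%:R `^ (- b) <= e1 / 2 by near: n.
  have H3 : ln n%:R * n%:R `^ (- b) <= e1 / 2.
    have L := ln_le_powR (divr_gt0 b0 (ltr0Sn R 1)) n0'.
    apply: le_trans (ler_wpM2r (powR_ge0 _ _) L) _.
    rewrite -mulrA -powRD ?(lt0r_neq0 n0') ?implybT // invf_div.
    have -> : b / 2 - b = - (b / 2) by lra.
    rewrite mulrC -ler_pdivlMr ?divr_gt0 //.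
    by near: n.
  have : C * (e1 / 2 + e1 / 2) <= e / 2.
    have -> : e1 / 2 + e1 / 2 = e1 by lra.
    by rewrite -e1E; nra.
  have : C * ((1 + ln n%:R) * n%:R `^ (- b)) <= C * (e1 / 2 + e1 / 2).
    by rewrite ler_wpM2l // mulrDl mul1r lerD.
  rewrite -!mulrA; lra.
- move=> p3; have p2 : 2 <= p by lra.
  have [K hK] := Rintegral_truncated_third_bounded mup p3.
  have l2 : 0 < ln 2 :> R by rewrite ln_gt0 // ltr1n.
  have K0 : 0 <= K by apply: le_trans (hK 0%N); exact: J0.
  (* For n >= 2 the bounded terms are absorbed through ln n >= ln 2; the final 1 makes the constant
     positive. *)
  apply/eqO_exP; exists (C + (C + 64 * K) / ln 2 + 1).
    by have : 0 <= (C + 64 * K) / ln 2 by [rewrite divr_ge0 ?(ltW l2) //; lra]; lra.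
  near=> n.
  have n1 : (1 < n)%N by near: n; exact: nbhs_infty_gt.
  have n0 : (0 < n)%N by exact: ltnW.
  apply: le_trans (V n p2 n0) _.
  have ln2n : ln 2 <= ln n%:R :> R by rewrite ler_ln ?posrE ?ltr0n // ler_nat.
  rewrite ger0_norm; last by rewrite (le_trans (ltW l2)).
  have : (C + 64 * K) <= (C + 64 * K) / ln 2 * ln n%:R.
    rewrite mulrAC ler_pdivlMr // ler_wpM2l //; lra.
  have := hK n; rewrite -/(J n); lra.
Unshelve. all: by end_near. Qed.
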